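(* Let $X$ be a standard Borel space and let $E\subseteq X^2$ be a countable Borel equivalence relation on $X$. If $E$ admits a locally-finite graphing $G$ such that each connected component of $G$ is a quasi-tree, then $E$ is treeable.
   Context: A graph on a set $X$ is a symmetric irreflexive binary relation $G\subseteq X^2$; it is locally-finite if each vertex has finitely many neighbours. A connected graph is regarded as a metric space via its path metric. A countable Borel equivalence relation on a standard Borel space $X$ is a Borel equivalence relation $E\subseteq X^2$ each of whose classes is countable. A graphing of $E$ is a graph $G$ on $X$ that is Borel as a subset of $X^2$ and whose connectedness relation (being joined by a finite $G$-path) is exactly $E$. A treeing of $E$ is a graphing of $E$ each of whose connected components is a tree (connected and acyclic); $E$ is treeable if it admits a treeing. Two metric spaces are quasi-isometric if they are isometric up to bounded multiplicative and additive error, i.e. there are $f:X\to Y$ and constants $L\ge 1$, $C\ge 0$ with $L^{-1}d(x,x')-C\le d(f(x),f(x'))\le L\,d(x,x')+C$ for all $x,x'\in X$ and every point of $Y$ within distance $C$ of $f(X)$. A quasi-tree is a metric space quasi-isometric to a simplicial tree. *)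

(* Defs.v *)
From mathcomp Require Import all_boot all_order all_algebra.
From mathcomp Require Import all_classical all_reals all_analysis.

Set Implicit Arguments.
Unset Strict Implicit.
Unset Printing Implicit Defensive.

Import Order.TTheory GRing.Theory Num.Theory.

Local Open Scope classical_set_scope.
Local Open Scope ring_scope.

(* A Polish space is a separable space with a complete Hausdorff pseudometric,
   [g_sigma_algebraType open] being its Borel space. The choice of [R] is
   immaterial, since all real types are isomorphic. *)
Definition standard_borel (R : realType) d (X : measurableType d) : Prop :=
  exists T : completePseudoMetricType R,
    [/\ hausdorff_space T,
        exists2 S : set T, countable S & dense S &
        exists f : X -> g_sigma_algebraType (@open T),
        exists g : g_sigma_algebraType (@open T) -> X,
          [/\ cancel f g, cancel g f,
              measurable_fun setT f & measurable_fun setT g]].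

Definition countable_borel_equivalence d (X : measurableType d)
    (E : set (X * X)) : Prop :=
  [/\ forall x, E (x, x),
      forall x y, E (x, y) -> E (y, x),
      forall x y z, E (x, y) -> E (y, z) -> E (x, z),
      measurable E &
      forall x, countable [set y | E (x, y)]].

Section Graphs.
Context {V : choiceType}.
Implicit Types (G : set (V * V)) (x y : V).

Definition is_graph G : Prop :=
  (forall x y, G (x, y) -> G (y, x)) /\ (forall x, ~ G (x, x)).

Definition locally_finite G : Prop := forall x, finite_set [set y | G (x, y)].

Definition adj G : rel V := [rel x y | (x, y) \in G].

(* [x :: p] is the vertex sequence of a path, which therefore has length
   [size p]; the trivial path [p = [::]] is allowed. *)
Definition paths G x y : set (seq V) :=
  [set p | path (adj G) x p /\ last x p = y].

Definition connectedness G : set (V * V) :=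
  [set xy | paths G xy.1 xy.2 !=set0].

Definition component G x : set V := [set y | connectedness G (x, y)].

(* [inf set0 = 0], so this is only meaningful on connected pairs. *)
Definition path_dist (R : realType) G x y : R :=
  inf [set (size p)%:R | p in paths G x y].

(* [ucycle] identifies the last vertex of [c] with a neighbour of the first;
   an edge traversed back and forth is a [ucycle] of size 2. *)
Definition acyclic G : Prop :=
  forall c : seq V, ucycle (adj G) c -> (size c < 3)%N.

Definition is_tree G : Prop :=
  [/\ is_graph G, connectedness G = setT & acyclic G].

End Graphs.

Definition component_graph (V : choiceType) (G : set (V * V)) (x : V) :
    set (component G x * component G x) :=
  [set uv | G (val uv.1, val uv.2)].
Arguments component_graph {V} G x.

Definition quasi_isometric (R : realType) (X Y : Type)
    (dX : X -> X -> R) (dY : Y -> Y -> R) : Prop :=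
  exists (f : X -> Y) (L C : R),
    [/\ 1 <= L, 0 <= C,
        forall x x', L^-1 * dX x x' - C <= dY (f x) (f x')
                     /\ dY (f x) (f x') <= L * dX x x' + C &
        forall y, exists x, dY y (f x) <= C].

Definition quasi_tree (R : realType) (X : Type) (dX : X -> X -> R) : Prop :=
  exists (V : choiceType) (T : set (V * V)),
    is_tree T /\ quasi_isometric dX (path_dist R T).

Definition graphing d (X : measurableType d) (E G : set (X * X)) : Prop :=
  [/\ is_graph G, measurable G & connectedness G = E].

Definition treeing d (X : measurableType d) (E G : set (X * X)) : Prop :=
  graphing E G /\ forall x, is_tree (component_graph G x).

Definition treeable d (X : measurableType d) (E : set (X * X)) : Prop :=
  exists T : set (X * X), treeing E T.

(* Main.v *)
Require Import Defs.
From mathcomp Require Import all_boot all_order all_algebra.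
From mathcomp Require Import all_classical all_reals all_analysis.
From mathcomp Require Import zify lra.

(* Every component of a locally finite graph whose components are quasi-trees
   has a bottleneck: outside any ball, two points of the sphere joined outside
   the ball are at distance at most r.  Hence the cuts given by points and by
   the components of complements of balls have boundaries of bounded diameter;
   each of them crosses only finitely many others, and each orientation of the
   cuts at finite distance from a point has finitely many minimal elements.
   The orientations form a median graph, an edge flipping a minimal element.
   Colour the cuts by natural numbers so that crossing cuts have distinct
   colours, and keep one edge flipping a cut among those whose endpoints differ
   only on cuts of smaller colour.  Any two orientations differing only below
   colour n + 1 are joined through the kept edges by induction on n, and a
   cycle would flip a wall of largest colour twice, hence use an edge twice; so
   the kept edges form a tree.  Contracting the Voronoi cells of the points of
   the component turns it into a tree on the component.
   All choices are made by least natural numbers or in a Borel linear order,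
   and quantifiers over a component become quantifiers over natural numbers by
   the Lusin-Novikov theorem, so the tree is Borel. *)

Set Implicit Arguments.
Unset Strict Implicit.
Unset Printing Implicit Defensive.

Import Order.TTheory GRing.Theory Num.Theory.

Local Open Scope classical_set_scope.

(** * Graph distance *)

(** Crossing walls make the graph of orientations far from a tree, and without a Borel choice of a
    point in each component no spanning tree can be grown from a root. The colours replace the root:
    edges flipping one wall are put in one class when they agree on every wall of at least its
    colour, and each class keeps a single edge. Infinitely many colours are harmless, because two
    orientations differ on finitely many walls, so that a largest colour exists wherever the
    argument needs one. The constant [r] may vary with the component: it occurs in finiteness proofs
    only and never in the definition of a cut, a colour or an edge, so nothing about it has to be
    Borel. Local finiteness makes balls finite, which turns bounded boundaries into finitely many
    crossings. The contraction is there because the vertices of the tree are orientations and not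
    points of the space; it creates no cycle since the cells are connected. *)

Section Distance.
Context {A : Type}.
Implicit Types (S : A -> A -> Prop) (x y z : A).

(** Distance at most [n] is kept as a relation instead of a number: it makes sense between
    unconnected points and on any type, and its measurability is an induction on [n]. *)
Fixpoint dle S (n : nat) x y : Prop :=
  if n is m.+1 then dle S m x y \/ exists2 z, dle S m x z & S z y else x = y.

Definition conn S x y : Prop := exists n, dle S n x y.

Definition restr S (P : A -> Prop) x y : Prop := [/\ S x y, P x & P y].

Definition symm S : Prop := forall x y, S x y -> S y x.

Lemma dle_refl S n x : dle S n x x.
Proof. by elim: n => [|n IH] //=; left. Qed.

Lemma dle_edge S n x y : 0 < n -> S x y -> dle S n x y.
Proof. by case: n => // n _ h; right; exists x => //; exact: dle_refl. Qed.

Lemma dle_leq S m n x y : m <= n -> dle S m x y -> dle S n x y.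
Proof.
elim: n => [|n IH]; first by rewrite leqn0 => /eqP->.
rewrite leq_eqVlt => /orP[/eqP-> //|]; rewrite ltnS => h /(IH h) /=; by left.
Qed.

Lemma dle_trans S m n x y z : dle S m x y -> dle S n y z -> dle S (m + n) x z.
Proof.
elim: n z => [|n IH] z /= h; first by move=> <-; rewrite addn0.
rewrite addnS => -[h1|[w h1 h2]] /=; first by left; apply: IH.
by right; exists w => //; apply: IH.
Qed.

Lemma dle_sym S n x y : symm S -> dle S n x y -> dle S n y x.
Proof.
move=> sS; elim: n x y => [|n IH] x y //= [h|[z h1 h2]]; first by left; apply: IH.
change (dle S (1 + n) y x); apply: dle_trans (IH _ _ h1).
by right; exists y => //; exact: sS.
Qed.

Lemma dle_sub S S' n x y : (forall a b, S a b -> S' a b) ->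
  dle S n x y -> dle S' n x y.
Proof.
move=> sub; elim: n y => [|n IH] y //= [h|[z h1 h2]]; first by left; apply: IH.
by right; exists z; [exact: IH | exact: sub].
Qed.

Lemma dle_split S n x y : dle S n x y ->
  forall a b, (a + b)%N = n -> exists2 z, dle S a x z & dle S b z y.
Proof.
elim: n y => [|n IH] y /=.
  by move=> -> a b /eqP; rewrite addn_eq0 => /andP[/eqP-> /eqP->]; exists y.
move=> h a [|b] ab; first by rewrite addn0 in ab; subst a; exists y.
have abn : (a + b)%N = n by lia.
case: h => [h|[z h1 h2]].
  by have [w h1 h2] := IH _ h a b abn; exists w => //=; left.
by have [w h3 h4] := IH _ h1 a b abn; exists w => //=; right; exists z.
Qed.

Lemma conn_refl S x : conn S x x.
Proof. by exists 0. Qed.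

Lemma conn_edge S x y : S x y -> conn S x y.
Proof. by exists 1; right; exists x. Qed.

Lemma conn_trans S x y z : conn S x y -> conn S y z -> conn S x z.
Proof. by move=> [m h1] [n h2]; exists (m + n); apply: dle_trans h1 h2. Qed.

Lemma conn_sym S x y : symm S -> conn S x y -> conn S y x.
Proof. by move=> sS [m h1]; exists m; apply: dle_sym. Qed.

Lemma conn_sub S S' x y : (forall a b, S a b -> S' a b) ->
  conn S x y -> conn S' x y.
Proof. by move=> sub [n h]; exists n; apply: dle_sub sub h. Qed.

Lemma conn_ind S (P : A -> Prop) x y :
  (forall a b, S a b -> P a -> P b) -> P x -> conn S x y -> P y.
Proof.
move=> step Px [n]; elim: n y => [|n IH] y /=; first by move=> <-.
by move=> [/IH //|[z /IH Pz /step]]; apply.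
Qed.

Lemma restr_symm S P : symm S -> symm (restr S P).
Proof. by move=> sS x y [h1 h2 h3]; split=> //; exact: sS. Qed.

Lemma conn_restrP S P x y : P x -> conn (restr S P) x y -> P y.
Proof. by move=> Px; apply: conn_ind Px => a b []. Qed.

Lemma restr_conn S P x y : conn (restr S P) x y -> conn S x y.
Proof. by apply: conn_sub => a b []. Qed.

(** A path of length [n] from [a] never leaves the ball of radius [n] around [a], so [P] need only
    hold there. *)
Lemma dle_restr S (P : A -> Prop) n a b : dle S n a b ->
  (forall z, dle S n a z -> P z) -> conn (restr S P) a b.
Proof.
elim: n b => [|n IH] b /=; first by move=> <- _; exact: conn_refl.
move=> [h|[z h1 h2]] av.
  by apply: IH => // c hc; apply: av; left.
apply: (@conn_trans _ _ z); first by apply: IH => // c hc; apply: av; left.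
apply: conn_edge; split=> //; first by apply: av; left.
by apply: av; right; exists z.
Qed.

Lemma finite_dle S n x : (forall x, finite_set [set y | S x y]) ->
  finite_set [set y | dle S n x y].
Proof.
move=> fin; elim: n => [|n IH] /=.
  by apply: (sub_finite_set _ (finite_set1 x)) => y /= ->.
apply: (@sub_finite_set _ _ ([set y | dle S n x y] `|`
   \bigcup_(z in [set z | dle S n x z]) [set y | S z y])).
  by move=> y /= [h|[z h1 h2]]; [left | right; exists z].
by rewrite finite_setU; split=> //; exact: bigcup_finite.
Qed.

End Distance.

Lemma conn_lift (A B : Type) (S : A -> A -> Prop) (S' : B -> B -> Prop)
    (h : A -> B) x y :
  (forall a b, S a b -> conn S' (h a) (h b)) -> conn S x y ->
  conn S' (h x) (h y).
Proof.
move=> step; apply: (@conn_ind _ S (fun y => conn S' (h x) (h y))) => //.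
  by move=> a b /step ab xa; apply: conn_trans ab.
exact: conn_refl.
Qed.

Section Paths.
Context {V : choiceType}.
Implicit Types (S : V -> V -> Prop) (x y z : V).

Lemma connP S x y : conn S x y <->
  exists p, path (fun a b => `[< S a b >]) x p /\ last x p = y.
Proof.
split.
  move=> [n]; elim: n y => [|n IH] y /=; first by move=> ->; exists [::].
  move=> [/IH //|[z /IH [p [h1 h2]] zy]].
  exists (rcons p y); rewrite rcons_path h1 h2 last_rcons; split=> //.
  exact/asboolP.
move=> [p]; elim: p x => [|z p IH] x /=; first by move=> [_ ->]; exact: conn_refl.
move=> [/andP[/asboolP xz h1] h2]; apply: conn_trans (conn_edge xz) _.
exact: IH.
Qed.

Lemma dleP S n x y : dle S n x y <->
  exists p, [/\ path (fun a b => `[< S a b >]) x p, last x p = y & size p <= n].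
Proof.
split.
  elim: n y => [|n IH] y /=; first by move=> ->; exists [::].
  move=> [/IH [p [h1 h2 h3]]|[z /IH [p [h1 h2 h3]] zy]].
    by exists p; split=> //; exact: leqW.
  exists (rcons p y); rewrite rcons_path h1 h2 last_rcons size_rcons; split=> //.
  exact/asboolP.
move=> [p]; elim: p x n => [|z p IH] x n /=.
  by move=> [_ -> _]; exact: dle_refl.
case: n => [|n]; first by case.
move=> [/andP[/asboolP xz h1] h2 h3]; change (dle S (1 + n) x y).
apply: dle_trans (dle_edge _ xz) (IH _ _ _) => //.
Qed.

Lemma conn_uniq S x y : conn S x y ->
  exists p, [/\ path (fun a b => `[< S a b >]) x p, last x p = y & uniq (x :: p)].
Proof.
by move=> /connP [p [h1 <-]]; case/shortenP: h1 => p' h1 h2 _; exists p'.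
Qed.

Definition edge_del S x y a b : Prop :=
  [/\ S a b, ~ (a = x /\ b = y) & ~ (a = y /\ b = x)].

(** Acyclicity as a statement about connectivity, a form that passes directly to contractions. *)
Definition bridges S : Prop := forall x y, S x y -> ~ conn (edge_del S x y) x y.

Lemma connectednessE (G : set (V * V)) x y :
  connectedness G (x, y) <-> conn (fun a b => G (a, b)) x y.
Proof.
rewrite connP; split=> -[p hp]; exists p; exact: hp.
Qed.

Lemma bridges_acyclic (G : set (V * V)) : is_graph G ->
  bridges (fun a b => G (a, b)) -> acyclic G.
Proof.
move=> [symG irrG] br c /andP[]; case: c => [|x [|y [|z c]]] //= h uc; exfalso.
have xy : G (x, y) by case/and3P: h => /asboolP.
apply: (br _ _ xy); set S := edge_del _ _ _.
have sS : symm S.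
  by move=> a b [h1 h2 h3]; split; [exact: symG | tauto | tauto].
apply: (conn_sym sS).
have {h} : path (adj G) y (rcons (z :: c) x) by case/andP: h.
move: uc => /and3P[]; rewrite inE negb_or => /andP[xNy] xq yq _ hp.
(* The part of the cycle from [y] back to [x]: as [s] is nonempty and contains neither [x] nor [y],
   none of the edges is the deleted one. *)
suff : forall s, path (adj G) y (rcons s x) -> x \notin s -> y \notin s -> s <> [::] -> conn S y x.
  by move=> hs; exact: (hs _ hp xq yq).
case=> [//|a s] /= /andP[ya {}hp] xs ys _.
have Sya : S y a.
  move: xs ys; rewrite !inE !negb_or => /andP[xa _] /andP[yna _].
  split; first exact/asboolP.
    by move=> [yx _]; move: xNy; rewrite yx eqxx.
  by move=> [_ ax]; move: xa; rewrite ax eqxx.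
apply: conn_trans (conn_edge Sya) _.
have {Sya ya xs} : a <> x /\ a <> y /\ x \notin s /\ y \notin s.
  move: xs ys; rewrite !inE !negb_or => /andP[/eqP xa ?] /andP[/eqP yna ?].
  by split; [|split] => // /esym.
elim: s a hp {ys} => [|b s IH] a /=.
  move=> /andP[/asboolP ax _] [h1 [h2 _]]; apply: conn_edge; split=> //; tauto.
move=> /andP[/asboolP ab hp] [h1 [h2]]; rewrite !inE !negb_or.
move=> [/andP[/eqP xb xs] /andP[/eqP yb ys]].
apply: (@conn_trans _ _ _ b); last first.
  by apply: IH => //; split; [|split] => // /esym.
by apply: conn_edge; split=> //; tauto.
Qed.

(** A simple path from [a] to [b] off [m], closed up through [m], is a cycle with at least three
    vertices unless [a] is [b]. *)
Lemma acyclic_avoid (G : set (V * V)) m a b : is_graph G -> acyclic G ->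
  G (m, a) -> G (m, b) -> conn (restr (fun a b => G (a, b)) (fun c => c <> m)) a b ->
  a = b.
Proof.
move=> [symG irrG] ac ma mb /conn_uniq [p [h1 h2 h3]].
apply: contrapT => ab.
have mNin : m \notin a :: p.
  have am : a <> m by move=> e; move: ma; rewrite e => /irrG.
  rewrite inE negb_or eq_sym; apply/andP; split; first exact/eqP.
  elim: p a h1 am {h2 h3 ab ma} => [//|c p IH] a /= /andP[/asboolP [_ _ cm] hp] _.
  by rewrite inE negb_or eq_sym; apply/andP; split; [exact/eqP | exact: IH hp cm].
have pn : p <> [::] by move=> e; move: h2; rewrite e.
have : (size (m :: a :: p) < 3)%N.
  apply: ac; apply/andP; split; last by rewrite cons_uniq mNin.
  rewrite /= rcons_path h2; apply/and3P; split; [exact/asboolP| |exact/asboolP/symG].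
  by apply: sub_path h1 => u v /asboolP [h _ _]; exact/asboolP.
by case: p pn {h1 h2 h3 mNin} => [|? [|? ?]].
Qed.

End Paths.
(** * Bottlenecks of quasi-trees *)

Section Separation.
Context {W : choiceType} (T : set (W * W)).
Hypotheses (Tgr : is_graph T) (Tac : acyclic T).
Let S a b := T (a, b).

Let Ssym : symm S. Proof. by case: Tgr. Qed.

Definition separates m a b : Prop :=
  a = m \/ b = m \/ ~ conn (restr S (fun c => c <> m)) a b.

Lemma separates_sym m a b : separates m a b -> separates m b a.
Proof.
move=> [|[|h]]; [by right; left | by left | right; right => hc; apply: h].
by apply: conn_sym hc; exact: restr_symm.
Qed.

(** [v] is the vertex just before the first visit of the given path to [c], which it has to visit
    because [c] separates its ends; [v] differs from [b] because the path avoids [b]. *)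
Lemma first_hit b c a o : a <> c -> separates c a o ->
  conn (restr S (fun z => z <> b)) a o ->
  exists v, [/\ S v c, v <> b & conn (restr S (fun z => z <> c)) a v].
Proof.
move=> ac sep hc.
have : conn (restr S (fun z => z <> c)) a o \/
  exists v, [/\ S v c, v <> b & conn (restr S (fun z => z <> c)) a v].
  apply: (@conn_ind _ _ (fun o => conn (restr S (fun z => z <> c)) a o \/
    exists v, [/\ S v c, v <> b & conn (restr S (fun z => z <> c)) a v]) _ _ _ _ hc);
    last by left; exact: conn_refl.
  move=> u v [uv ub vb] [h|]; last by right.
  have [vc|vc] := pselect (v = c); first by subst v; right; exists u.
  left; apply: (conn_trans h); apply: conn_edge; split=> //.
  exact: (conn_restrP (P := fun z => z <> c) ac h).
move=> [h|//]; case: sep => [//|[oc|//]].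
by have := conn_restrP (P := fun z => z <> c) ac h.
Qed.

(** Induction along the path from [o] to [b]. When the endpoint moves from [c] to its neighbour [b],
    a median other than [c] stays a median, and the median [c] either stays or moves to [b]. In the
    last case [first_hit] and acyclicity show that [b] separates [a] from [o]. *)
Lemma tree_median a b o : conn S o b ->
  exists m, [/\ separates m a b, separates m a o & separates m b o].
Proof.
apply: (@conn_ind _ _ (fun b => exists m,
  [/\ separates m a b, separates m a o & separates m b o])); last first.
  by exists o; split; rewrite /separates; tauto.
move=> c {}b cb [m [h1 h2 h3]].
have bc : b <> c by move=> e; case: Tgr => _ irr; apply: (irr b); rewrite {1}e.
have [mc|mc] := pselect (m = c); last first.
  have [bm|bm] := pselect (b = m).
    by subst m; exists b; split=> //; rewrite /separates; tauto.
  have cbm : conn (restr S (fun z => z <> m)) c b by apply: conn_edge; split=> //; exact: nesym.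
  exists m; split=> //.
    have [am|am] := pselect (a = m); first by left.
    right; right => h; case: h1 => [//|[/esym//|]]; apply.
    by apply: conn_trans h (conn_sym _ cbm); exact: restr_symm.
  have [om|om] := pselect (o = m); first by right; left.
  right; right => h; case: h3 => [/esym//|[//|]]; apply.
  exact: conn_trans cbm h.
subst m => {h1 h3}.
have [hab|hab] := pselect (separates c a b); last first.
  have [ac [_ /contrapT cab]] : a <> c /\ b <> c /\ ~ ~ conn (restr S (fun z => z <> c)) a b.
    by move: hab; rewrite /separates; tauto.
  exists b; split; rewrite /separates; try tauto.
  apply: contrapT => /not_orP[ab /not_orP[ob /contrapT h]].
  have [v [vc vb av]] := first_hit ac h2 h.
  apply: vb; apply: (acyclic_avoid Tgr Tac (m := c)) => //.
    exact: Ssym.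
  by apply: conn_trans cab; apply: conn_sym av; exact: restr_symm.
have [hbo|hbo] := pselect (separates c b o); first by exists c.
have [oc [/contrapT cbo]] : o <> c /\ ~ ~ conn (restr S (fun z => z <> c)) b o /\ True.
  by move: hbo; rewrite /separates; tauto.
exists b; split; rewrite /separates; try tauto.
apply: contrapT => /not_orP[ab /not_orP[ob /contrapT h]].
have h' := conn_sym (restr_symm (P := fun z => z <> b) Ssym) h.
have [v [vc vb ov]] := first_hit oc (separates_sym h2) h'.
apply: vb; apply: (acyclic_avoid Tgr Tac (m := c)) => //.
  exact: Ssym.
apply: conn_sym; first exact: restr_symm.
exact: conn_trans cbo ov.
Qed.

(** The images of consecutive points are joined by paths of length at most [J], which together lead
    from [f x] to [f y] and so meet [m]. The lengths [a] and [b] record the position of [u] on the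
    path. *)
Lemma coarse_path_meets (A : Type) (SA : A -> A -> Prop) (f : A -> W) J n x y m :
  (forall u v, SA u v -> dle S J (f u) (f v)) ->
  dle SA n x y -> separates m (f x) (f y) ->
  exists a b u, [/\ (a + b)%N = n, dle SA a x u, dle SA b u y & dle S J (f u) m].
Proof.
move=> fJ xy sep; apply: contrapT => no.
have av a b u : (a + b)%N = n -> dle SA a x u -> dle SA b u y ->
    forall z, dle S J (f u) z -> z <> m.
  by move=> h1 h2 h3 z h4 zm; apply: no; exists a, b, u; rewrite -zm.
have key a b u : (a + b)%N = n -> dle SA a x u -> dle SA b u y ->
    conn (restr S (fun z => z <> m)) (f x) (f u).
  elim: a b u => [|a IH] b u ab; first by move=> /= ->; move=> *; exact: conn_refl.
  move=> [h1|[w h1 wu]] h2.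
    by apply: (IH b.+1) => //=; [lia | left].
  have h3 : dle SA b.+1 w y.
    by change (dle SA (1 + b) w y); apply: dle_trans h2; exact: dle_edge.
  have abn : (a + b.+1)%N = n by lia.
  apply: conn_trans (IH _ _ abn h1 h3) _.
  by apply: dle_restr (fJ _ _ wu) _; exact: av abn h1 h3.
have := key n 0 y (addn0 n) xy erefl.
have := av 0 n x (add0n n) erefl xy _ (dle_refl _ _ _).
have := av n 0 y (addn0 n) xy erefl _ (dle_refl _ _ _).
by move: sep; rewrite /separates; tauto.
Qed.

End Separation.

Definition away {A : Type} (G : A -> A -> Prop) n x y z : Prop :=
  ~ dle G n x y /\ conn (restr G (fun c => ~ dle G n x c)) y z.

Definition bottleneck {A : Type} (G : A -> A -> Prop) (C : set A) r : Prop :=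
  forall x n y z, C x -> away G n x y z -> dle G n.+1 x y -> dle G n.+1 x z ->
    dle G r y z.

(** Let [m] be the median of the images of [x], [y] and [z]. The path from [y] to [z] outside the
    ball has a point [w] with image near [m]; so does a path of length [n.+1] from [x] to [y], at a
    point [u] which is then within [c] of [w]. As [w] lies outside the ball, [u] is within [c] of
    the end [y], so [y] is within [2c] of [w]. The same holds for [z], whence [4c]. *)
Lemma bottleneck_of_quasi_tree (A : Type) (G : A -> A -> Prop) (C : set A)
    (W : choiceType) (T : set (W * W)) (f : A -> W) J c :
  symm G -> (forall u v, C u -> G u v -> C v) ->
  is_graph T -> acyclic T -> (forall a b, conn (fun a b => T (a, b)) a b) ->
  (forall u v, C u -> G u v -> dle (fun a b => T (a, b)) J (f u) (f v)) ->
  (forall u v, C u -> C v -> dle (fun a b => T (a, b)) (J + J) (f u) (f v) ->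
     dle G c u v) ->
  bottleneck G C ((c + c) + (c + c)).
Proof.
move=> sG Ccl Tgr Tac Tc fJ fc x n y z Cx [xy yz] hy hz.
have sT : symm (fun a b => T (a, b)) by case: Tgr.
have Cdle u v k : C u -> dle G k u v -> C v.
  move=> Cu h; apply: (@conn_ind _ G C u) => //; last by exists k.
  by move=> a b /[swap]; exact: Ccl.
have dC u v k : C u -> dle G k u v -> dle (fun a b => C a /\ G a b) k u v.
  move=> Cu; elim: k v => [|k IH] v //= [h|[w h1 h2]]; first by left; exact: IH.
  by right; exists w; [exact: IH | split=> //; exact: Cdle h1].
have Cy := Cdle _ _ _ Cx hy; have Cz := Cdle _ _ _ Cx hz.
have [m [m1 m2 m3]] := tree_median Tgr Tac (f y) (Tc (f x) (f z)).
have fJ' u v : C u /\ G u v -> dle (fun a b => T (a, b)) J (f u) (f v).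
  by case; exact: fJ.
have Gsub u v : C u /\ G u v -> G u v by case.
have [w [xw wm Cw]] : exists w, [/\ ~ dle G n x w, dle (fun a b => T (a, b)) J (f w) m & C w].
  have [k hk] := yz.
  set P := fun c => ~ dle G n x c.
  have hk' : dle (fun a b => C a /\ restr G P a b) k y z.
    elim: k z hk {yz hz Cz m1 m3} => [|k IH] z //= [h|[u h1 h2]].
      by left; exact: IH.
    right; exists u; [exact: IH | split=> //].
    by apply: (Cdle y u k) => //; apply: dle_sub h1 => a b [].
  have [|a [b [w [_ h1 _ h2]]]] := coarse_path_meets _ hk' m1 (J := J).
    by move=> u v [Cu [uv _ _]]; exact: fJ.
  exists w; split=> //.
    apply: (@conn_restrP _ G P y) => //; exists a.
    by apply: dle_sub h1 => ? ? [].
  by apply: (Cdle y w a) => //; apply: dle_sub h1 => ? ? [_ []].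
have near v : C v -> dle G n.+1 x v -> separates T m (f v) (f x) -> dle G (c + c) v w.
  move=> Cv hv sv.
  have [a [b [u [ab h1 h2 h3]]]] :=
    coarse_path_meets fJ' (dC _ _ _ Cx hv) (separates_sym Tgr sv).
  have {}h1 := dle_sub Gsub h1; have {}h2 := dle_sub Gsub h2.
  have Cu := Cdle _ _ _ Cx h1.
  have uw : dle G c u w.
    by apply: fc => //; apply: dle_trans h3 (dle_sym _ wm).
  have lt : n < a + c.
    rewrite ltnNge; apply/negP => le; apply: xw.
    by apply: dle_leq le _; exact: dle_trans h1 uw.
  apply: dle_trans uw; apply: (@dle_leq _ _ b); first by lia.
  exact: dle_sym.
apply: dle_trans (near y Cy hy m2) _.
by apply: dle_sym => //; exact: near.
Qed.

Lemma path_dist_le (R : realType) (V : choiceType) (G : set (V * V)) n x y :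
  dle (fun a b => G (a, b)) n x y -> (path_dist R G x y <= n%:R)%R.
Proof.
move=> /dleP [p [h1 h2 h3]].
have lb : has_lbound [set ((size p)%:R : R)%R | p in paths G x y].
  by exists 0%R => _ [q _ <-]; exact: ler0n.
apply: (@le_trans _ _ (size p)%:R%R); last by rewrite ler_nat.
by apply: ge_inf => //; exists p.
Qed.

(** The strict bound by [n.+1] spares a proof that the infimum is attained: some path has length
    below [n.+1], that is at most [n]. *)
Lemma dle_path_dist (R : realType) (V : choiceType) (G : set (V * V)) n x y :
  conn (fun a b => G (a, b)) x y -> (path_dist R G x y < n.+1%:R)%R ->
  dle (fun a b => G (a, b)) n x y.
Proof.
move=> /connP [p0 hp0] lt.
have [|_ [p hp <-] h] := @inf_lt _ [set ((size p)%:R : R)%R | p in paths G x y] _ _ lt.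
  by exists (size p0)%:R%R, p0.
apply/dleP; exists p; case: hp => h1 h2; split=> //.
by move: h; rewrite ltr_nat ltnS.
Qed.

Lemma dle_component_graph (V : choiceType) (G : set (V * V)) x0 n
    (u v : component G x0) :
  dle (fun a b => component_graph G x0 (a, b)) n u v <->
  dle (fun a b => G (a, b)) n (val u) (val v).
Proof.
split.
  elim: n v => [|n IH] v /=; first by move=> ->.
  by move=> [h|[w h1 h2]]; [left; exact: IH | right; exists (val w) => //; exact: IH].
elim: n v => [|n IH] v /=; first by move=> h; exact: val_inj.
move=> [h|[w h1 h2]]; [by left; exact: IH | right].
have hw : component G x0 w.
  apply/connectednessE/conn_trans; last by exists n; exact: h1.
  by apply/connectednessE; have := set_valP u.
exists (SigSub (mem_set hw)) => //.
exact: IH.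
Qed.

Lemma quasi_tree_bottleneck (R : realType) (V : choiceType) (G : set (V * V)) x0 :
  is_graph G -> quasi_tree (path_dist R (component_graph G x0)) ->
  exists r, bottleneck (fun a b => G (a, b)) (component G x0) r.
Proof.
move=> [symG irrG] [W [T [[Tgr Tc Tac] [f [L [K [L1 K0 hf _]]]]]]].
have Tconn a b : conn (fun a b => T (a, b)) a b.
  by apply/connectednessE; rewrite Tc.
(* [J] bounds the distance between the images of adjacent points, and [c] the distance between
   points whose images are at distance at most [2J]. Strict bounds by a successor are what
   [dle_path_dist] takes. *)
have [J hJ] : exists J : nat, (L + K < J.+1%:R)%R.
  exists (Num.truncn (L + K)); apply: truncnS_gt.
have [c hc] : exists c : nat, (L * ((J + J)%:R + K) < c.+1%:R)%R.
  exists (Num.truncn (L * ((J + J)%:R + K))); apply: truncnS_gt.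
have x0P : component G x0 x0 by apply/connectednessE; exact: conn_refl.
pose f' u := if pselect (component G x0 u) is left h then f (SigSub (mem_set h))
             else f (SigSub (mem_set x0P)).
have f'E u (hu : component G x0 u) : f' u = f (SigSub (mem_set hu)).
  rewrite /f'; case: pselect => // h; congr f; exact: val_inj.
have Ccl u v : component G x0 u -> G (u, v) -> component G x0 v.
  move=> /connectednessE hu uv; apply/connectednessE.
  exact: conn_trans hu (conn_edge _).
have Cconn (u v : component G x0) : conn (fun a b => component_graph G x0 (a, b)) u v.
  have /connectednessE hu := set_valP u; have /connectednessE hv := set_valP v.
  have [n hn] := conn_trans (conn_sym symG hu) hv.
  by exists n; exact/dle_component_graph.
exists ((c + c) + (c + c))%N.
apply: (@bottleneck_of_quasi_tree _ _ _ _ T f' J c) => //.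
  move=> u v Cu uv; have Cv := Ccl _ _ Cu uv; rewrite (f'E u Cu) (f'E v Cv).
  apply: (@dle_path_dist R) => //; apply: le_lt_trans hJ.
  apply: le_trans (hf _ _).2 _; rewrite lerD2r ler_piMr //; first exact: le_trans L1.
  apply: (@path_dist_le R _ _ 1); apply/dle_component_graph.
  exact: dle_edge.
move=> u v Cu Cv; rewrite (f'E u Cu) (f'E v Cv) => /(@path_dist_le R) h.
apply/(@dle_component_graph _ _ x0 _ (SigSub (mem_set Cu)) (SigSub (mem_set Cv))).
apply: (@dle_path_dist R) => //; apply: le_lt_trans hc.
have L0 : (0 < L)%R by exact: lt_le_trans L1.
rewrite -ler_pdivrMl // -lerBlDr; exact: le_trans (hf _ _).1 h.
Qed.
(** * Cuts *)

(** The members are told apart by their traces on [B], of which there are finitely many; the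
    induction removes a point of [B] and splits the family by membership of that point. *)
Lemma finite_set_traces (A : choiceType) (F : set (set A)) (B : set A) :
  finite_set B ->
  (forall H K, F H -> F K -> (forall b, B b -> (H b <-> K b)) -> H = K) ->
  finite_set F.
Proof.
move=> /finite_seqP [s ->]; elim: s F => [|a s IH] F inj.
  have [[H FH]|no] := pselect (exists H, F H).
    apply: (sub_finite_set _ (finite_set1 H)) => K FK /=.
    by apply: inj => // b.
  by apply: (sub_finite_set _ (finite_set0 _)) => K FK; apply: no; exists K.
apply: (@sub_finite_set _ _ ([set H | F H /\ H a] `|` [set H | F H /\ ~ H a])).
  by move=> H FH; have [Ha|Ha] := pselect (H a); [left | right].
rewrite finite_setU; split; apply: IH => H K [FH Ha] [FK Ka] hs.
all: apply: inj => // b; rewrite /= inE => /orP[/eqP->|]; last exact: hs.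
all: by split.
Qed.

Lemma finite_set_bound (A : choiceType) (F : set A) (P : A -> nat -> Prop) :
  finite_set F ->
  (forall H, F H -> exists n, forall m, P H m -> m < n) ->
  exists n, forall H m, F H -> P H m -> m < n.
Proof.
move=> /finite_seqP [s ->]; elim: s => [|a s IH] bnd; first by exists 0.
have [n hn] : exists n, forall H m, [set` s] H -> P H m -> m < n.
  by apply: IH => H hH; apply: bnd; rewrite /= inE; apply/orP; right.
have [m hm] := bnd a (mem_head _ _).
exists (maxn n m) => H k; rewrite /= inE leq_max => /orP[/eqP->|hH] hk.
  by rewrite (hm _ hk) orbT.
by rewrite (hn _ _ hH hk).
Qed.

Section CutDefs.
Context {X : choiceType} (G : X -> X -> Prop) (C : set X).
Implicit Types (H K : set X).

(* Singletons are included so that distinct points define distinct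
   orientations. *)
Definition bcut n x y : set X :=
  if n is m.+1 then [set z | away G m x y z] else [set x].

Definition half_space H : Prop :=
  [/\ exists x y n, [/\ C x, C y & H = bcut n x y \/ H = C `\` bcut n x y],
      H !=set0 & C `\` H !=set0].

(** Endpoints on both sides are taken, so that a half-space and its complement have one boundary. *)
Definition boundary H : set X := [set a | exists2 b, G a b & (H a <-> ~ H b)].

Definition cross H K : Prop :=
  [/\ ~ (H `<=` K), ~ (H `<=` C `\` K), ~ (C `\` H `<=` K)
    & ~ (C `\` H `<=` C `\` K)].

(** The half-spaces near [H] are those whose colours have to be pairwise distinct: the two sides of
    the wall of [H] and everything that crosses it. *)
Definition near H K : Prop := [\/ K = H, K = C `\` H | cross H K].

Definition minimal (U : set (set X)) H : Prop :=
  U H /\ forall K, U K -> K `<=` H -> K = H.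

End CutDefs.

Section Cuts.
Context {X : choiceType} (G : X -> X -> Prop) (C : set X) (r : nat).
Hypotheses (Gsym : symm G) (Gfin : forall x, finite_set [set y | G x y]).
Hypotheses (Ccl : forall u v, C u -> G u v -> C v).
Hypotheses (Cconn : forall u v, C u -> C v -> conn G u v).
Hypothesis Cbot : bottleneck G C r.
Implicit Types (H K D : set X) (x y z a b : X).

Lemma class_dle n u v : C u -> dle G n u v -> C v.
Proof.
move=> Cu h; apply: (@conn_ind _ G C u) => //; last by exists n.
by move=> a b /[swap]; exact: Ccl.
Qed.

Lemma bcut_sub n x y : C x -> C y -> bcut G n x y `<=` C.
Proof.
case: n => [|n] Cx Cy z /=; first by move=> ->.
by move=> [_ h]; have [k] := restr_conn h; exact: class_dle.
Qed.

Lemma half_space_sub H : half_space G C H -> H `<=` C.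
Proof.
by move=> [[x [y [n [Cx Cy [->|->]]]]] _ _]; [exact: bcut_sub | move=> z []].
Qed.

Lemma setDK H : H `<=` C -> C `\` (C `\` H) = H.
Proof. by move=> HC; rewrite setDD; exact/setIidPr. Qed.

Lemma half_space_star H : half_space G C H -> half_space G C (C `\` H).
Proof.
move=> hH; have HC := half_space_sub hH; case: hH => [[x [y [n [Cx Cy e]]]] h1 h2].
split=> //; last by rewrite setDK.
exists x, y, n; split=> //; case: e => ->; first by right.
by left; rewrite setDK //; exact: bcut_sub.
Qed.

Lemma bdP H a : ~ boundary G H a -> forall b, G a b -> (H a <-> H b).
Proof.
move=> nbd b ab; have [Ha|Ha] := pselect (H a).
  split=> // _; apply: contrapT => Hb; apply: nbd; exists b => //; tauto.
split=> // Hb; exfalso; apply: nbd; exists b => //; tauto.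
Qed.

Lemma bdP2 H a b : G a b -> ~ boundary G H b -> (H a <-> H b).
Proof. by move=> ab nbd; have := bdP nbd (Gsym ab); tauto. Qed.

Lemma bd_sub H : H `<=` C -> boundary G H `<=` C.
Proof.
move=> HC a [b ab h]; have [Ha|Ha] := pselect (H a); first exact: HC.
by apply: (Ccl _ (Gsym ab)); apply: HC; apply: contrapT => Hb; tauto.
Qed.

Lemma bd_star H : boundary G (C `\` H) `<=` boundary G H.
Proof.
move=> a [b ab h]; exists b => //; move: h (fun c => Ccl c ab) (fun c => Ccl c (Gsym ab)).
rewrite /setD /mkset; have [Ha|Ha] := pselect (H a); have [Hb|Hb] := pselect (H b);
  by have [Ca|Ca] := pselect (C a); tauto.
Qed.

Lemma bd_inout H a : boundary G H a -> exists2 b, G a b & (H a /\ ~ H b) \/ (~ H a /\ H b).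
Proof.
move=> [b ab h]; exists b => //.
have [Ha|Ha] := pselect (H a); first by left; tauto.
by right; split=> //; apply: contrapT; tauto.
Qed.

Lemma dle_bd H n a b : dle G n a b -> ~ (H a <-> H b) ->
  exists2 h, boundary G H h & dle G n a h.
Proof.
move=> h nab; apply: contrapT => no; apply: nab.
have : forall z, dle G n a z -> ~ boundary G H z by move=> z hz hb; apply: no; exists z.
elim: n b h {no} => [|n IH] b /=; first by move=> <-.
move=> [h|[w h1 h2]] no; first by apply: IH => // z hz; apply: no; left.
have := IH w h1 (fun z hz => no z (or_introl hz)).
by have := bdP (no w (or_introl h1)) h2; tauto.
Qed.

Lemma bcut_edge n x y a b : bcut G n.+1 x y a -> G a b -> ~ bcut G n.+1 x y b ->
  dle G n x b.
Proof.
move=> [h1 h2] ab hb; apply: contrapT => nb; apply: hb; split=> //.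
apply: (conn_trans h2); apply: conn_edge; split=> //.
exact: (conn_restrP (P := fun c => ~ dle G n x c) h1 h2).
Qed.

Lemma bcut_far n x y a : bcut G n.+1 x y a -> ~ dle G n x a.
Proof. by move=> [h1 h2]; exact: (conn_restrP (P := fun c => ~ dle G n x c) h1 h2). Qed.

(** Up to one step, a boundary point is a point of the cut at distance exactly [n.+1] from [x],
    since edges leave the cut only into the ball; two such points are within [r] of each other. The
    two extra steps give [r + 2], which also covers the boundary of a singleton. *)
Lemma bd_diam H a b : half_space G C H -> boundary G H a -> boundary G H b -> dle G (r + 2) a b.
Proof.
move=> [[x [y [n [Cx Cy e]]]] _ _].
suff : boundary G (bcut G n x y) a -> boundary G (bcut G n x y) b -> dle G (r + 2) a b.
  by case: e => -> // h /bd_star ? /bd_star ?; exact: h.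
move=> {H e}; case: n => [|n].
  have sub c : boundary G [set x] c -> dle G 1 x c.
    move=> /bd_inout [d cd [[-> _]|[_ /= dx]]]; first exact: dle_refl.
    by apply: (@dle_edge _ G 1) => //; apply: Gsym; rewrite -dx.
  move=> /sub ha /sub hb; apply: (@dle_leq _ G 2); first by lia.
  by apply: (dle_trans (dle_sym Gsym ha) hb).
set D := bcut G n.+1 x y.
have sub c : boundary G D c -> exists c', [/\ D c', dle G n.+1 x c' & dle G 1 c c'].
  move=> /bd_inout [d cd [[Dc Dd]|[Dc Dd]]].
    exists c; split=> //; last exact: dle_refl.
    by right; exists d; [exact: bcut_edge Dc cd Dd | exact: Gsym].
  exists d; split=> //; last exact: dle_edge.
  by right; exists c => //; exact: bcut_edge Dd (Gsym cd) Dc.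
move=> /sub [a' [Da ha aa]] /sub [b' [Db hb bb]].
rewrite addnC -[2]/(1 + 1)%N -addnA; apply: dle_trans aa _.
rewrite addnC; apply: dle_trans (dle_sym Gsym bb).
apply: (Cbot Cx _ ha hb); split; first exact: bcut_far Da.
have sR := restr_symm (P := fun c => ~ dle G n x c) Gsym.
by apply: conn_trans (conn_sym sR Da.2) Db.2.
Qed.

Lemma bd_nonempty H : half_space G C H -> exists a, boundary G H a.
Proof.
move=> hH; have HC := half_space_sub hH; case: hH => [_ [u Hu] [v [Cv Hv]]].
have [n uv] := Cconn (HC _ Hu) Cv.
have [|h hb _] := dle_bd (H := H) uv; last by exists h.
by tauto.
Qed.

(** The two sets agree at a boundary point, and on a walk from there an edge into a point outside
    [B] changes membership in neither of them. *)
Lemma bd_determines H K (B : set X) : half_space G C H -> half_space G C K ->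
  boundary G H `<=` B -> boundary G K `<=` B -> (forall b, B b -> (H b <-> K b)) -> H = K.
Proof.
move=> hH hK HB KB HK; have HC := half_space_sub hH; have KC := half_space_sub hK.
have [b0 hb0] := bd_nonempty hH.
have Cb0 := bd_sub HC hb0.
have key z : C z -> (H z <-> K z).
  move=> /(Cconn Cb0); apply: (@conn_ind _ _ (fun z => H z <-> K z)); last first.
    by apply: HK; exact: HB.
  move=> a b ab hab; have [Bb|Bb] := pselect (B b); first exact: HK.
  have := bdP2 ab (fun h => Bb (HB _ h)); have := bdP2 ab (fun h => Bb (KB _ h)).
  by tauto.
by apply/seteqP; split=> z hz; apply/key => //; [exact: HC | exact: KC].
Qed.

Lemma finite_nbhd n (A : set X) : finite_set A ->
  finite_set (\bigcup_(a in A) [set y | dle G n a y]).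
Proof. by move=> fA; apply: bigcup_finite => // a _; exact: finite_dle. Qed.

(** A boundary that meets [A] lies in the finite [r + 2]-neighbourhood of [A], and the trace on this
    neighbourhood determines the half-space. *)
Lemma finite_half_space_meeting (A : set X) : finite_set A ->
  finite_set [set H | half_space G C H /\ exists2 a, A a & boundary G H a].
Proof.
move=> fA; have fB := finite_nbhd (r + 2) fA.
apply: (finite_set_traces fB) => H K [hH [a Aa Ha]] [hK [b Ab Kb]].
apply: bd_determines => //.
  by move=> h hh; exists a => //=; exact: bd_diam hH Ha hh.
by move=> h hh; exists b => //=; exact: bd_diam hK Kb hh.
Qed.

Lemma finite_bd H : half_space G C H -> finite_set (boundary G H).
Proof.
move=> hH; have [a ha] := bd_nonempty hH.
apply: (sub_finite_set _ (finite_dle (r + 2) a Gfin)) => b hb.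
exact: bd_diam hH ha hb.
Qed.

(** A walk from a point outside [H] towards [H] meets no boundary point of [K] before it enters [H],
    so membership in [K] can be read off at a boundary point of [H]. Two boundary points of [H] are
    joined by a path of length at most [r + 2], which by assumption meets no boundary point of
    [K]. *)
Lemma outside_const H K : half_space G C H -> half_space G C K ->
  (forall h a, boundary G H h -> dle G (r + 2) h a -> ~ boundary G K a) ->
  boundary G K `<=` H -> forall u v, C u -> ~ H u -> C v -> ~ H v -> (K u <-> K v).
Proof.
move=> hH hK far KH.
have proj u : C u -> ~ H u -> exists2 u', boundary G H u' & (K u <-> K u').
  move=> Cu Hu; have HC := half_space_sub hH.
  have [_ [w Hw] _] := hH.
  have := Cconn Cu (HC _ Hw).
  have : forall z, conn G u z -> (exists2 u', boundary G H u' & (K u <-> K u')) \/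
      (~ H z /\ (K u <-> K z)).
    move=> z; apply: (@conn_ind _ _ (fun z => (exists2 u', boundary G H u' & (K u <-> K u')) \/
      (~ H z /\ (K u <-> K z)))); last by right.
    move=> a b ab [h|[Ha h]]; first by left.
    have [Hb|Hb] := pselect (H b).
      by left; exists a => //; exists b => //; tauto.
    right; split=> //; have := bdP (fun h => Ha (KH _ h)) ab; tauto.
  by move=> h /h [//|[]].
move=> u v Cu Hu Cv Hv.
have [u' bu eu] := proj u Cu Hu; have [v' bv ev] := proj v Cv Hv.
suff : K u' <-> K v' by tauto.
apply: contrapT => uv.
have [h hb hd] := dle_bd (bd_diam hH bu bv) uv.
exact: far bu hd hb.
Qed.

(** If the boundaries are far apart, that of [K], having diameter at most [r + 2], lies on one side
    of [H]. By [outside_const], [K] is constant on the other side, so [K] or its complement contains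
    that side and the pair is nested. *)
Lemma cross_meets H K : half_space G C H -> half_space G C K -> cross C H K ->
  exists2 h, boundary G H h & exists2 a, dle G (r + 2) h a & boundary G K a.
Proof.
move=> hH hK [c1 c2 c3 c4]; apply: contrapT => no.
have far h a : boundary G H h -> dle G (r + 2) h a -> ~ boundary G K a.
  by move=> h1 h2 h3; apply: no; exists h => //; exists a.
have KC := bd_sub (half_space_sub hK).
have [in_|out] := pselect (boundary G K `<=` H).
  have := outside_const hH hK far in_; have [_ _ [v [Cv Hv]]] := hH.
  move=> const; have [Kv|Kv] := pselect (K v).
    by apply: c3 => u [Cu Hu]; apply/(const u v).
  by apply: c4 => u [Cu Hu]; split=> // /(const u v Cu Hu Cv Hv).
have {}out : boundary G K `<=` C `\` H.
  have [a [ha Ha]] : exists a, boundary G K a /\ ~ H a.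
    by apply: contrapT => h; apply: out => a ha; apply: contrapT => Ha; apply: h; exists a.
  move=> b hb; split; first exact: KC.
  move=> Hb; have [|h h1 h2] := dle_bd (H := H) (bd_diam hK ha hb); first by tauto.
  exact: far h1 (dle_sym Gsym h2) ha.
have hH' := half_space_star hH; have HC := half_space_sub hH.
have far' h a : boundary G (C `\` H) h -> dle G (r + 2) h a -> ~ boundary G K a.
  by move=> /bd_star; exact: far.
have := outside_const hH' hK far' out; have [_ [v Hv] _] := hH.
have HH u : H u -> ~ (C `\` H) u by move=> Hu [].
move=> const; have Cv := HC _ Hv; have [Kv|Kv] := pselect (K v).
  by apply: c1 => u Hu; apply/(const u v); auto.
by apply: c2 => u Hu; split; [exact: HC | move=> /(const u v (HC _ Hu) (HH _ Hu) Cv (HH _ Hv))].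
Qed.

Lemma finite_near H : half_space G C H -> finite_set [set K | half_space G C K /\ near C H K].
Proof.
move=> hH; have fB := finite_nbhd (r + 2) (finite_bd hH).
have fM := finite_half_space_meeting fB.
apply: (@sub_finite_set _ _ ([set H] `|` [set C `\` H] `|`
  [set K | half_space G C K /\ exists2 a, (\bigcup_(a in boundary G H) [set y | dle G (r + 2) a y]) a & boundary G K a])).
  move=> K [hK [->|->|HK]]; [by left; left | by left; right | right].
  have [h h1 [a h2 h3]] := cross_meets hH hK HK.
  by split=> //; exists a => //; exists h.
by rewrite !finite_setU.
Qed.

Lemma finite_separating x y : C x -> C y ->
  finite_set [set H | half_space G C H /\ H x /\ ~ H y].
Proof.
move=> Cx Cy; have [n xy] := Cconn Cx Cy.
apply: (sub_finite_set _ (finite_half_space_meeting (finite_dle n x Gfin))).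
move=> H [hH [Hx Hy]]; split=> //.
have [|h h1 h2] := dle_bd (H := H) xy; first by tauto.
by exists h.
Qed.

(* Far away cuts [H] around [x] are not minimal in an orientation [U] close to
   [x]: the component [D] of the complement of a large ball containing the
   boundary of [H] yields a smaller element [C `\` D] of [U]. *)
Lemma finite_minimal (U : set (set X)) x : C x -> U `<=` half_space G C ->
  (forall H, half_space G C H -> U H \/ U (C `\` H)) ->
  finite_set [set H | U H /\ ~ H x] ->
  finite_set [set H | minimal U H].
Proof.
move=> Cx Uhs Uor fF.
(* The radius in any presentation of [H] as a cut around [x] is bounded by the distance from [x] to
   a boundary point of [H], so the finitely many [H] have a common bound [N]. *)
have hN H : U H /\ ~ H x -> exists n, forall m, (exists y, C y /\ H = bcut G m.+1 x y) -> m < n.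
  move=> [UH Hx]; have hH := Uhs _ UH; have HC := half_space_sub hH.
  have [a ha] := bd_nonempty hH.
  have [k xa] := Cconn Cx (bd_sub HC ha).
  exists k.+1 => n [y [Cy e]]; rewrite e in ha.
  have /bd_inout [b ab [[Ha Hb]|[Ha Hb]]] := ha.
    by rewrite ltnS ltnW // ltnNge; apply/negP => le; apply: (bcut_far Ha); exact: dle_leq le xa.
  rewrite ltnNge; apply/negP => le; apply: (bcut_far Hb); apply: dle_leq le _.
  by right; exists a.
have [N {}hN] := finite_set_bound fF hN.
(* A boundary beyond this radius, having diameter at most [r + 2], can be walked through outside the
   ball of radius [N], and none of its points is within [N.+1] of [x]. *)
have fM := finite_half_space_meeting (finite_dle (N + r + 3) x Gfin).
apply: (@sub_finite_set _ _ ([set H | U H /\ ~ H x] `|`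
   [set H | half_space G C H /\ exists2 a, dle G (N + r + 3) x a & boundary G H a])); last first.
  by rewrite finite_setU.
move=> H [UH Hmin]; have [Hx|Hx] := pselect (H x); last by left.
right; split; first exact: Uhs.
apply: contrapT => no.
have hH := Uhs _ UH; have HC := half_space_sub hH.
have {}no a : boundary G H a -> ~ dle G (N + r + 3) x a.
  by move=> h1 h2; apply: no; exists a.
have [h hbd] := bd_nonempty hH.
have Ch := bd_sub HC hbd.
pose D := bcut G N.+1 x h.
have bdD : boundary G H `<=` D.
  have far z : dle G (r + 2) h z -> ~ dle G N x z.
    move=> hz xz; apply: (no h hbd).
    apply: (@dle_leq _ G (N + (r + 2))); first by lia.
    exact: dle_trans xz (dle_sym _ hz).
  move=> h' hh'; split; first by apply: far; exact: dle_refl.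
  by apply: dle_restr (bd_diam hH hbd hh') _.
have Dx : ~ D x by move=> /bcut_far; apply; exact: dle_refl.
have hD : half_space G C D.
  split; first by exists x, h, N.+1; split=> //; left.
    by exists h; exact: bdD.
  by exists x.
(* [N] exceeds the radius of every cut around [x] that is in [U] and misses [x]. *)
have nUD : ~ U D.
  by move=> UD; have := hN D N (conj UD Dx) (ex_intro _ h (conj Ch erefl)); rewrite ltnn.
have UK : U (C `\` D) by case: (Uor D hD).
(* Induction on the distance from [x]. A path that comes out of [D] does so into the ball of radius
   [N], hence can be replaced by a shorter one; an edge with both ends off [D] does not cross the
   boundary of [H]. *)
have KH : C `\` D `<=` H.
  move=> a [Ca]; have [k xa] := Cconn Cx Ca.
  elim: k a xa {Ca} => [|k IH] a /=; first by move=> <-.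
  move=> [xa|[w xw wa]] Da; first exact: IH.
  have [Dw|Dw] := pselect (D w).
    have xa := bcut_edge Dw wa Da.
    have lt : N < k.
      by rewrite ltnNge; apply/negP => le; apply: (bcut_far Dw); exact: dle_leq le xw.
    by apply: IH => //; exact: dle_leq (ltnW lt) xa.
  have nb : ~ boundary G H a by move=> hb; apply: Da; exact: bdD.
  by apply/(bdP2 wa nb); exact: IH.
(* Now [H] is the complement of [D] while its boundary lies in [D]; an edge that leaves [D] at [h]
   puts [h] within [N.+1] of [x]. *)
have e := Hmin _ UK KH.
have Dh := bdD _ hbd.
have /bd_inout [b hb [[Hh _]|[_ Hb]]] := hbd.
  by move: Hh; rewrite -e => -[_]; apply.
move: Hb; rewrite -e => -[Cb Db].
apply: (no h hbd); apply: (@dle_leq _ G N.+1); first by lia.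
by right; exists b; [exact: bcut_edge Dh hb Db | exact: Gsym].
Qed.

End Cuts.
(** * The tree of orientations *)

Lemma nat_least (P : nat -> Prop) : (exists n, P n) ->
  exists n, P n /\ forall m, m < n -> ~ P m.
Proof.
move=> [n Pn]; elim/ltn_ind: n Pn => n IH Pn.
have [[m [mn Pm]]|no] := pselect (exists m, m < n /\ P m); first exact: IH Pm.
by exists n; split=> // m mn Pm; apply: no; exists m.
Qed.

Lemma nat_argmax (k : nat) (f : nat -> nat) : 0 < k ->
  exists2 i, i < k & forall j, j < k -> f j <= f i.
Proof.
case: k => // k _; elim: k => [|k [i ik hi]]; first by exists 0 => // -[].
have [le|/ltnW le] := leqP (f k.+1) (f i).
  by exists i => [|j]; [lia | rewrite ltnS leq_eqVlt => /orP[/eqP-> //|/hi]].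
exists k.+1 => // j; rewrite ltnS leq_eqVlt => /orP[/eqP-> //|/hi h].
exact: leq_trans h le.
Qed.

Lemma finite_minimal_set (X : Type) (F : set (set X)) : finite_set F -> F !=set0 ->
  exists2 H, F H & forall K, F K -> K `<=` H -> K = H.
Proof.
move=> /finite_seqP [s ->] [H0]; case: s => [|a s]; first by [].
move=> _; elim: s a => [|b s IH] a.
  by exists a; rewrite /= ?inE // => K; rewrite inE => /eqP.
have [H Hs Hmin] := IH b.
have [[aH naH]|no] := pselect (a `<=` H /\ a <> H).
  exists a; first by rewrite /= mem_head.
  move=> K; rewrite /= inE => /orP[/eqP // |Ks Ka].
  have KH := Hmin K Ks (subset_trans Ka aH).
  by case: naH; apply/seteqP; split=> //; rewrite -KH.
exists H; first by rewrite /= inE; apply/orP; right.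
move=> K; rewrite /= inE => /orP[/eqP -> aH|Ks]; last exact: Hmin.
by apply: contrapT => naH; apply: no.
Qed.

Definition seq_of_nat (k : nat) : seq nat := odflt [::] (unpickle k).

Lemma seq_of_nat_pickle s : seq_of_nat (pickle s) = s.
Proof. by rewrite /seq_of_nat pickleK. Qed.

Section OrientationDefs.
Context {X : choiceType} (C : set X) (Hs : set (set X)) (c : set X -> nat).
Implicit Types (H K : set X) (U V : set (set X)).

(** These are the ultrafilters on the half-spaces ordered by inclusion, the last clause keeping
    those at finite distance from the principal ones: the vertices of the cube complex dual to the
    walls. *)
Definition orientation U : Prop :=
  [/\ U `<=` Hs, forall H, Hs H -> (U H <-> ~ U (C `\` H)),
      forall H K, U H -> Hs K -> H `<=` K -> U K &
      forall x, C x -> finite_set [set H | U H /\ ~ H x]].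

Definition principal (x : X) : set (set X) := [set H | Hs H /\ H x].

Definition flip_orientation U H : set (set X) := [set K | (U K /\ K <> H) \/ K = C `\` H].

Definition wall_color H : nat := minn (c H) (c (C `\` H)).

(** Only members of [U] missing from [V] are tested: between orientations the converse follows by
    complementation, as the two sides of a wall have one wall colour. *)
Definition differ_below n U V : Prop :=
  forall K, U K -> ~ V K -> wall_color K < n.

(** A countable name for [U] once [H] is fixed: orientations in which [H] is minimal differ only on
    half-spaces crossing [H], and colours are injective near [H], so the set of these colours
    determines the orientation. *)
Definition label U H (s : seq nat) : Prop :=
  forall m, m \in s <-> exists K, [/\ U K, near C H K & c K = m].

(* Among the edges flipping [H] whose endpoints differ only on walls of smaller
   colour, exactly one, of least label, is kept. *)
Definition selected_flip U H : Prop := exists k, label U H (seq_of_nat k) /\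
  forall V k', orientation V -> minimal V H -> differ_below (wall_color H) U V ->
    k' < k -> ~ label V H (seq_of_nat k').

(** The inequality of colours chooses one side of the wall, so that an edge is described from one
    end only. *)
Definition tree_flip H U V : Prop :=
  [/\ orientation U, minimal U H, c H < c (C `\` H), selected_flip U H & V = flip_orientation U H].

Definition tree_edge U V : Prop :=
  exists H, tree_flip H U V \/ tree_flip H V U.

End OrientationDefs.

Section Orientations.
Context {X : choiceType} (C : set X) (Hs : set (set X)) (c : set X -> nat).
Implicit Types (H K : set X) (U V W : set (set X)).
Hypotheses (C0 : C !=set0) (HsC : forall H, Hs H -> H `<=` C).
Hypotheses (HsN : forall H, Hs H -> H !=set0)
           (Hstar : forall H, Hs H -> Hs (C `\` H)).
Hypothesis near_fin : forall H, Hs H -> finite_set [set K | Hs K /\ near C H K].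
Hypothesis c_inj : forall L H K, Hs L -> Hs H -> Hs K ->
  near C L H -> near C L K -> c H = c K -> H = K.
Hypothesis sep_fin : forall x y, C x -> C y ->
  finite_set [set H | Hs H /\ H x /\ ~ H y].
Hypothesis min_fin : forall U, orientation C Hs U -> finite_set [set H | minimal U H].

Local Notation vertex := (orientation C Hs).
Local Notation flip := (flip_orientation C).
Local Notation w := (wall_color C c).
Local Notation differ_below := (differ_below C c).
Local Notation selected := (selected_flip C Hs c).
Local Notation tree_flip := (tree_flip C Hs c).
Local Notation tree_edge := (tree_edge C Hs c).

Lemma starK H : Hs H -> C `\` (C `\` H) = H.
Proof. by move=> /HsC HC; rewrite setDD; exact/setIidPr. Qed.

Lemma star_neq H : Hs H -> H <> C `\` H.
Proof. by move=> hH e; have [x Hx] := HsN hH; move: (Hx); rewrite e => -[]. Qed.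

Lemma starS H K : H `<=` K -> C `\` K `<=` C `\` H.
Proof. by move=> HK x [Cx Kx]; split=> // /HK. Qed.

Lemma near_refl H : near C H H.
Proof. exact: Or31. Qed.

Lemma near_star H : near C H (C `\` H).
Proof. exact: Or32. Qed.

Lemma cross_star H K : Hs K -> cross C H K -> cross C H (C `\` K).
Proof. by move=> hK [c1 c2 c3 c4]; split=> //; rewrite starK. Qed.

Lemma vertex_star U H : vertex U -> Hs H -> ~ U H -> U (C `\` H).
Proof. by move=> [_ h _ _] /h hH nU; apply: contrapT; tauto. Qed.

Lemma vertex_principal x : C x -> vertex (principal Hs x).
Proof.
move=> Cx; split.
- by move=> H [].
- move=> H hH; split; first by move=> [_ Hx] [_ []].
  move=> n; split=> //; apply: contrapT => Hx; apply: n; split=> //.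
  exact: Hstar.
- by move=> H K [hH Hx] hK HK; split=> //; exact: HK.
- move=> y Cy; apply: (sub_finite_set _ (sep_fin Cx Cy)).
  by move=> H [[hH Hx] Hy].
Qed.

(** A half-space in [U] but not in [V] either misses [x] or has a complement in [V] that misses [x];
    each case leaves finitely many. *)
Lemma vertex_diff_finite U V : vertex U -> vertex V -> finite_set [set H | U H /\ ~ V H].
Proof.
move=> vU vV; have [x Cx] := C0.
have [Us Uc Uu Uf] := vU; have [Vs Vc Vu Vf] := vV.
apply: (@sub_finite_set _ _ ([set H | U H /\ ~ H x] `|`
   (setD C @` [set H | V H /\ ~ H x]))).
  move=> H [UH VH]; have [Hx|Hx] := pselect (H x); last by left.
  right; exists (C `\` H); last by apply: starK; exact: Us.
  by split; [apply: vertex_star => //; exact: Us | move=> []].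
by rewrite finite_setU; split; [exact: Uf | exact/finite_image/Vf].
Qed.

Lemma vertex_sub_eq U V : vertex U -> vertex V -> U `<=` V -> U = V.
Proof.
move=> vU vV UV; apply/seteqP; split=> // H VH; apply: contrapT => UH.
have [Vs Vc _ _] := vV; have hH := Vs _ VH.
by apply: ((Vc _ hH).1 VH); apply: UV; exact: vertex_star.
Qed.

(** Minimality is what upward closure needs: no other member of [U] lies below [H], and a set above
    the complement of [H] that is missing from [U] has its complement below [H], hence equal to
    [H]. *)
Lemma flip_vertex U H : vertex U -> minimal U H -> vertex (flip U H).
Proof.
move=> vU [UH Hmin]; have [Us Uc Uu Uf] := vU; have hH := Us _ UH.
have HsH := Hstar hH; have Hne := star_neq hH.
split.
- by move=> K [[/Us]|->].
- move=> K hK; rewrite /flip_orientation /mkset.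
  have [->|KH] := pselect (K = H); first by tauto.
  have [->|KsH] := pselect (K = C `\` H).
    by rewrite starK //; have := nesym Hne; tauto.
  have nsK : C `\` K <> H by move=> e; apply: KsH; rewrite -e starK.
  have nsK' : C `\` K <> C `\` H by move=> e; apply: KH; rewrite -(starK hK) e starK.
  have := Uc _ hK; tauto.
- move=> K L [[UK KH]|->] hL KL.
    have [LH|LH] := pselect (L = H).
      by case: KH; apply: Hmin => //; rewrite -LH.
    by left; split=> //; exact: Uu KL.
  have [->|LsH] := pselect (L = C `\` H); [by right | left; split].
    apply: contrapT => nUL; apply: LsH.
    have UsL := vertex_star vU hL nUL.
    have sLH : C `\` L `<=` H by rewrite -(starK hH); exact: starS.
    by rewrite -(starK hL) (Hmin _ UsL sLH).
  move=> LH; have [x [Cx Hx]] := HsN HsH.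
  by apply: (Hx); rewrite -LH; apply: KL.
- move=> x Cx; apply: (@sub_finite_set _ _ ([set H | U H /\ ~ H x] `|` [set C `\` H])).
    by move=> K [[[UK _]|->] Kx]; [left | right].
  by rewrite finite_setU; split; [exact: Uf | exact: finite_set1].
Qed.

Lemma flip_star U H : vertex U -> U H -> flip (flip U H) (C `\` H) = U.
Proof.
move=> [Us Uc _ _] UH; have hH := Us _ UH.
have Hne := star_neq hH; have nU := (Uc _ hH).1 UH.
rewrite /flip_orientation starK //; apply/seteqP; split=> K /=.
  by move=> [[[[]|->] //]|->].
move=> UK; have [->|KH] := pselect (K = H); [by right | left; split; first by left].
by move=> e; apply: nU; rewrite -e.
Qed.

Lemma flip_minimal U H : vertex U -> minimal U H -> minimal (flip U H) (C `\` H).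
Proof.
move=> [Us Uc Uu _] [UH _]; have hH := Us _ UH; split; first by right.
move=> K [[UK KH]|//] KsH; exfalso.
by apply: ((Uc _ hH).1 UH); apply: Uu KsH => //; exact: Hstar.
Qed.

(** A minimal element of the finite set of members of [U] missing from [V] is minimal in all of [U]:
    a member of [U] below it that was in [V] would put it into [V]. *)
Lemma exists_minimal U V : vertex U -> vertex V -> ~ (U `<=` V) ->
  exists2 H, minimal U H & ~ V H.
Proof.
move=> vU vV UV; have [|H [UH VH] Hmin] := finite_minimal_set (vertex_diff_finite vU vV).
  apply: contrapT => no; apply: UV => H UH; apply: contrapT => VH; apply: no.
  by exists H.
exists H => //; split=> // K UK KH; apply: Hmin => //; split=> // VK.
by apply: VH; case: vV => _ _ Vu _; case: vU => Us _ _ _; apply: Vu KH => //; exact: Us.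
Qed.

(** Each nesting of [H] and [K] contradicts upward closure or the minimality of [H] in one of the
    two orientations. Thus all edges flipping [H] are parallel: their ends differ only on walls that
    cross [H]. *)
Lemma minimal_differ_cross U V H K : vertex U -> vertex V ->
  minimal U H -> minimal V H -> U K -> ~ V K -> cross C H K.
Proof.
move=> vU vV [UH Umin] [VH Vmin] UK VK.
have [Us Uc Uu _] := vU; have [Vs Vc Vu _] := vV.
have hH := Us _ UH; have hK := Us _ UK.
have VsK := vertex_star vV hK VK.
split=> h.
- by apply: VK; exact: Vu h.
- by apply: ((Uc _ hK).1 UK); apply: Uu h => //; exact: Hstar.
- have sKH : C `\` K `<=` H by rewrite -(starK hH); exact: starS.
  have e := Vmin _ VsK sKH; apply: ((Uc _ hH).1 UH).
  by rewrite -e starK.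
- have KH : K `<=` H by rewrite -(starK hH) -(starK hK); exact: starS.
  by apply: VK; rewrite (Umin _ UK KH).
Qed.

Lemma wall_color_star H : Hs H -> w (C `\` H) = w H.
Proof. by move=> hH; rewrite /wall_color starK // minnC. Qed.

Lemma cross_neq H K : Hs H -> Hs K -> cross C H K -> [/\ K <> H & K <> C `\` H].
Proof.
move=> hH hK [c1 c2 c3 c4]; split=> e; first by apply: c1; rewrite e.
by apply: c3; rewrite e.
Qed.

Lemma cross_wall_color H K : Hs H -> Hs K -> cross C H K -> w K <> w H.
Proof.
move=> hH hK HK; have sHK := cross_star hK HK; have hsK := Hstar hK.
have hsH := Hstar hH.
have ne L M : L = H \/ L = C `\` H -> M = K \/ M = C `\` K -> c M <> c L.
  move=> hL hM e.
  have hsL : Hs L by case: hL => ->.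
  have [hsM cM] : Hs M /\ cross C H M by case: hM => ->.
  have nL : near C H L by case: hL => ->; [exact: near_refl | exact: near_star].
  have [n1 n2] := cross_neq hH hsM cM.
  by case: hL (c_inj hH hsM hsL (Or33 _ _ cM) nL e) => ->.
by rewrite /wall_color /minn; case: ifP => _; case: ifP => _; apply: ne; auto.
Qed.

Lemma differ_below_sym n U V : vertex U -> vertex V ->
  differ_below n U V -> differ_below n V U.
Proof.
move=> vU vV d K VK UK; have [Vs Vc _ _] := vV; have hK := Vs _ VK.
rewrite -(wall_color_star hK); apply: d; first exact: vertex_star.
exact: (Vc _ hK).1.
Qed.

Lemma differ_below_trans n U V W : differ_below n U V -> differ_below n V W ->
  differ_below n U W.
Proof.
move=> d1 d2 K UK WK; have [VK|VK] := pselect (V K); [exact: d2 | exact: d1].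
Qed.

Lemma differ_below_leq m n U V : m <= n -> differ_below m U V -> differ_below n U V.
Proof. by move=> mn d K UK VK; apply: leq_trans mn; exact: d. Qed.

(** Edges of one class compete for the least label, so both have the same one; a half-space on which
    [U] and [V] differ crosses [H] and is recovered from its colour in the common label. *)
Lemma selected_uniq U V H : vertex U -> vertex V -> minimal U H -> minimal V H ->
  differ_below (w H) U V -> selected U H -> selected V H -> U = V.
Proof.
move=> vU vV mU mV d [k [lk hk]] [k' [lk' hk']].
have e : k = k'.
  have [lt|lt|//] := ltngtP k k'; exfalso.
    exact: (hk' U k vU mU (differ_below_sym vU vV d) lt).
  exact: (hk V k' vV mV d lt).
subst k'; apply: vertex_sub_eq => // K UK; apply: contrapT => VK.
have HK := minimal_differ_cross vU vV mU mV UK VK.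
have [Us _ _ _] := vU; have [Vs _ _ _] := vV.
have : c K \in seq_of_nat k by apply/lk; exists K; split=> //; exact: Or33.
move=> /lk' [L [VL nL cL]]; apply: VK.
by rewrite -(c_inj (Us _ mU.1) (Vs _ VL) (Us _ UK) nL (Or33 _ _ HK) cL).
Qed.

Lemma label_exists U H : vertex U -> Hs H -> exists s, label C c U H s.
Proof.
move=> [Us _ _ _] hH.
have : finite_set (c @` [set K | U K /\ near C H K]).
  apply: finite_image; apply: (sub_finite_set _ (near_fin hH)) => K [UK nK].
  by split=> //; exact: Us.
move=> /finite_seqP [s hs]; exists s => m.
change ([set` s] m <-> exists K, [/\ U K, near C H K & c K = m]); rewrite -hs.
by split=> [[K [h1 h2] h3]|[K [h1 h2 h3]]]; exists K.
Qed.

Lemma selected_exists U H : vertex U -> minimal U H ->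
  exists V, [/\ vertex V, minimal V H, differ_below (w H) U V & selected V H].
Proof.
move=> vU mU.
have hH : Hs H by case: vU => Us _ _ _; apply: Us; exact: mU.1.
have [|k [[V [vV mV dV lV]] hk]] := @nat_least (fun k => exists V,
  [/\ vertex V, minimal V H, differ_below (w H) U V & label C c V H (seq_of_nat k)]).
  have [s hs] := label_exists vU hH.
  exists (pickle s), U; rewrite seq_of_nat_pickle; split=> //.
exists V; split=> //; exists k; split=> // V' k' vV' mV' d' lt lab.
by apply: (hk k' lt); exists V'; split=> //; exact: differ_below_trans d'.
Qed.

Lemma tree_edge_symm : symm tree_edge.
Proof. by move=> U V [H [h|h]]; exists H; [right | left]. Qed.

(** The kept edge of the class flips the same wall at some [V]. Since [U] and [V] differ only on
    colours below [n], and so do their flips, the edge from [U] to its flip is replaced by a detour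
    through the kept edge. If [H] is the side of larger colour, the detour is run backwards. *)
Lemma tree_step n U H :
  (forall U V, vertex U -> vertex V -> differ_below n U V -> conn tree_edge U V) ->
  vertex U -> minimal U H -> w H <= n -> conn tree_edge U (flip U H).
Proof.
move=> IH.
have key U' H' : vertex U' -> minimal U' H' -> w H' <= n ->
    c H' < c (C `\` H') -> conn tree_edge U' (flip U' H').
  move=> vU mU wn pH; have [V [vV mV dV sV]] := selected_exists vU mU.
  have vfV := flip_vertex vV mV; have vfU := flip_vertex vU mU.
  have dn := differ_below_leq wn dV.
  apply: conn_trans (IH _ _ vU vV dn) _.
  apply: (@conn_trans _ _ _ (flip V H')).
    by apply: conn_edge; exists H'; left.
  apply: IH => // K; rewrite /flip_orientation /mkset => hK nK; apply: (differ_below_sym vU vV dn).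
    by tauto.
  by tauto.
move=> vU mU wn; have [Us _ _ _] := vU; have hH := Us _ mU.1.
have [lt|lt|e] := ltngtP (c H) (c (C `\` H)); first exact: key.
  apply: conn_sym; first exact: tree_edge_symm.
  rewrite -{2}(flip_star vU mU.1); apply: key.
  - exact: flip_vertex.
  - exact: flip_minimal.
  - by rewrite wall_color_star.
  - by rewrite starK.
case: (star_neq hH).
exact: (c_inj hH hH (Hstar hH) (near_refl H) (near_star H) e).
Qed.

Lemma tree_conn_below n U V : vertex U -> vertex V -> differ_below n U V ->
  conn tree_edge U V.
Proof.
elim: n U V => [|n IH] U V vU vV d.
  rewrite (@vertex_sub_eq U V) //; first exact: conn_refl.
  by move=> K UK; apply: contrapT => VK; have := d _ UK VK.
have [s hs] := (finite_seqP _).1 (vertex_diff_finite vU vV).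
have {hs} : forall K, U K -> ~ V K -> K \in s.
  by move=> K UK VK; change ([set` s] K); rewrite -hs.
(* Inner induction on the length of a list containing the half-spaces still to be flipped; each flip
   of a minimal one removes it from the list. *)
move: {2}(size s) (leqnn (size s)) => k; elim: k s U vU d => [|k IHk] s U vU d sk hs.
  rewrite (@vertex_sub_eq U V) //; first exact: conn_refl.
  move=> K UK; apply: contrapT => VK; have := hs _ UK VK.
  by case: s sk {hs}.
have [UV|UV] := pselect (U `<=` V).
  by rewrite (@vertex_sub_eq U V) //; exact: conn_refl.
have [H mH VH] := exists_minimal vU vV UV.
have [Us _ _ _] := vU; have hH := Us _ mH.1.
apply: (conn_trans (tree_step IH vU mH (d _ mH.1 VH))).
have VsH := vertex_star vV hH VH.
apply: (IHk [seq K <- s | K != H]).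
- exact: flip_vertex.
- by move=> K [[UK _]|->] // VK; exact: d.
- have : H \in s by exact: hs mH.1 VH.
  rewrite -has_pred1 has_count size_filter => h0.
  rewrite -ltnS; apply: leq_trans sk; rewrite -(count_predC (pred1 H) s).
  by rewrite -[X in X < _]add0n ltn_add2r.
- move=> K [[UK KH]|->] // VK; rewrite mem_filter; apply/andP; split; first exact/eqP.
  exact: hs.
Qed.

Lemma tree_conn U V : vertex U -> vertex V -> conn tree_edge U V.
Proof.
move=> vU vV.
have [|n hn] := finite_set_bound (P := fun K n => n = w K) (vertex_diff_finite vU vV).
  by move=> K _; exists (w K).+1 => m ->.
by apply: (@tree_conn_below n) => // K UK VK; exact: hn (conj UK VK) erefl.
Qed.

Lemma tree_edge_vertex U V : tree_edge U V -> vertex U /\ vertex V.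
Proof.
by move=> [H [[h1 h2 _ _ ->]|[h1 h2 _ _ ->]]]; split=> //; exact: flip_vertex.
Qed.

Lemma finite_tree_edge U : finite_set [set V | tree_edge U V].
Proof.
have [vU|nU] := pselect (vertex U); last first.
  apply: (sub_finite_set _ (finite_set0 _)) => V /= h.
  by apply: nU; exact: (tree_edge_vertex h).1.
apply: (sub_finite_set _ (finite_image (flip U) (min_fin vU))).
move=> V [H [[h1 h2 _ _ ->]|[h1 h2 _ _ ->]]]; first by exists H.
exists (C `\` H); first exact: flip_minimal.
exact: flip_star h1 h2.1.
Qed.

(** When both walls are named by their side of smaller colour, distinct names mean distinct
    walls. *)
Lemma flip_other U H K : Hs K -> c H < c (C `\` H) -> c K < c (C `\` K) ->
  Hs H -> K <> H -> (flip U H K <-> U K).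
Proof.
move=> hK pH pK hH KH; rewrite /flip_orientation /mkset; split; last by left.
move=> [[]//|e]; move: pK pH; rewrite e starK // => h1 h2.
by have := ltn_trans h1 h2; rewrite ltnn.
Qed.

(* The walls of largest colour flipped along a cycle are flipped at least
   twice, through the same selected edge. *)
Lemma tree_bridges : bridges tree_edge.
Proof.
suff key H U V : tree_flip H U V -> ~ conn (edge_del tree_edge U V) U V.
  move=> U V [H [h|h]]; first exact: key h.
  move=> /(conn_sym _) hc; apply: (key _ _ _ h).
  apply: conn_sub (hc _); first by move=> A B [h1 h2 h3]; split=> //; tauto.
  by move=> A B [h1 h2 h3]; split; [exact: tree_edge_symm | tauto | tauto].
move=> hUV /conn_uniq [p [hp lp up]].
have [vU mU pH sU eV] := hUV; have [Us _ _ _] := vU; have hH := Us _ mU.1.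
pose W i := nth U (U :: p) i; pose k := size p.
have W0 : W 0 = U by [].
have Wk : W k = V by rewrite -lp /W /k -last_nth.
have Winj i j : i <= k -> j <= k -> W i = W j -> i = j.
  by move=> ik jk /eqP; rewrite nth_uniq // => /eqP.
have Wedge i : i < k -> edge_del tree_edge U V (W i) (W i.+1).
  by move=> ik; have /(pathP U) /(_ i ik) /asboolP := hp.
have /choice [K hK] : forall i, exists K, i < k ->
    tree_flip K (W i) (W i.+1) \/ tree_flip K (W i.+1) (W i).
  move=> i; have [ik|ik] := ltnP i k; last by exists set0.
  by have [[L hL] _ _] := Wedge i ik; exists L.
have hsK i : i < k -> Hs (K i).
  by move=> /hK [[[Vs _ _ _] [m _] _ _ _]|[[Vs _ _ _] [m _] _ _ _]]; exact: Vs.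
have prK i : i < k -> c (K i) < c (C `\` K i) by move=> /hK [[]|[]].
have vW i : i <= k -> vertex (W i).
  case: i => [|i] ik; first by rewrite W0.
  by have [e _ _] := Wedge i ik; exact: (tree_edge_vertex e).2.
have const L i : Hs L -> c L < c (C `\` L) -> i < k -> K i <> L ->
    (W i L <-> W i.+1 L).
  move=> hL pL ik KL.
  have other A B : tree_flip (K i) A B -> (B L <-> A L).
    by move=> [_ _ _ _ ->]; apply: flip_other => //; [exact: prK|exact: hsK|exact: nesym].
  by have [h|h] := hK i ik; have := other _ _ h; tauto.
have consts L i j : Hs L -> c L < c (C `\` L) -> i <= j -> j <= k ->
    (forall l, i <= l < j -> K l <> L) -> (W i L <-> W j L).
  move=> hL pL; elim: j => [|j IH]; first by rewrite leqn0 => /eqP->.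
  rewrite leq_eqVlt => /orP[/eqP-> //|]; rewrite ltnS => ij jk KL.
  rewrite IH //; [apply: const => //; apply: KL; lia | exact: ltnW|].
  by move=> l /andP[h1 h2]; apply: KL; lia.
have [_ VH] : U H /\ ~ V H.
  split; first exact: mU.1.
  rewrite eV => -[[_]//|e]; exact: (star_neq hH e).
(* If only walls of smaller colour were flipped on the way, [H] would keep its side from [U] to
   [V]. *)
have [small|[i0 i0k big]] : (forall i, i < k -> w (K i) < w H) \/
    (exists2 i, i < k & w H <= w (K i)).
    have [h|no] := pselect (exists2 i, i < k & w H <= w (K i)); first by right.
    by left=> i ik; rewrite ltnNge; apply/negP => le; apply: no; exists i.
  apply: VH; rewrite -Wk; apply/(consts H 0 k) => //.
  - by move=> l /= lk e; have := small l lk; rewrite e ltnn.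
  - exact: mU.1.
have [i ik imax] := nat_argmax (fun i => w (K i)) (leq_ltn_trans (leq0n _) i0k).
set m := w (K i) in imax *.
have Hm : w H <= m by exact: leq_trans big (imax _ i0k).
have step l : l < k -> differ_below m.+1 (W l) (W l.+1).
  move=> lk.
  have d A B : tree_flip (K l) A B -> differ_below m.+1 A B.
    move=> [_ _ _ _ ->] L AL BL.
    have -> : L = K l by apply: contrapT => e; apply: BL; left.
    by rewrite ltnS; exact: imax.
  have [h|h] := hK l lk; first exact: d h.
  by apply: differ_below_sym (d _ _ h); apply: vW => //; exact: ltnW.
have dW l : l <= k -> differ_below m.+1 U (W l).
  elim: l => [|l IH] lk; first by rewrite W0 => L h1 h2.
  exact: differ_below_trans (IH (ltnW lk)) (step l lk).
have dW2 a b : a <= k -> b <= k -> differ_below m.+1 (W a) (W b).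
  move=> ak bk; apply: differ_below_trans (dW b bk).
  by apply: differ_below_sym (dW a ak) => //; exact: vW.
(* The starting ends differ only on walls crossing [L], whose colour is not [m] and hence is
   smaller, so the two edges belong to one class of selection. *)
have same L A B A' B' : w L = m -> differ_below m.+1 A A' ->
    tree_flip L A B -> tree_flip L A' B' -> A = A' /\ B = B'.
  move=> wL d [vA mA pA sA ->] [vA' mA' pA' sA' ->].
  have [As _ _ _] := vA.
  suff -> : A = A' by [].
  apply: (selected_uniq vA vA' mA mA') => //.
  move=> M AM A'M; have cr := minimal_differ_cross vA vA' mA mA' AM A'M.
  have hL := As _ mA.1.
  have := cross_wall_color hL (As _ AM) cr.
  by have := d _ AM A'M; rewrite wL; lia.
have WK : ~ (W i (K i) <-> W i.+1 (K i)).
  have ne := star_neq (hsK i ik).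
  have d A B : tree_flip (K i) A B -> A (K i) /\ ~ B (K i).
    by move=> [_ [AK _] _ _ ->]; split=> // -[[]|].
  by have [h|h] := hK i ik; have := d _ _ h; tauto.
(* If the wall of largest colour is that of [H], the edge at [i] is the deleted one. *)
have [KiH|KiH] := pselect (K i = H).
  have wHm : w H = m by rewrite -KiH.
  have [_ n1 n2] := Wedge i ik.
  have [h|h] := hK i ik; rewrite KiH in h.
    by have [e1 e2] := same _ _ _ _ _ wHm (dW i (ltnW ik)) hUV h; apply: n1.
  by have [e1 e2] := same _ _ _ _ _ wHm (dW _ ik) hUV h; apply: n2.
(* Otherwise [U] and [V] agree on [K i], so this wall is flipped again at some [j]; the edges at [i]
   and [j] coincide, against the simplicity of the path. *)
have [j [jk ji Kji]] : exists j, [/\ j < k, j <> i & K j = K i].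
  apply: contrapT => no; apply: WK.
  have hi := hsK i ik; have pri := prK i ik.
  have h1 : W 0 (K i) <-> W i (K i).
    apply: consts => //; first exact: ltnW.
    by move=> l /= li e; apply: no; exists l; split=> //; lia.
  have h2 : W i.+1 (K i) <-> W k (K i).
    apply: consts => //.
    by move=> l /andP[h2 h3] e; apply: no; exists l; split=> //; lia.
  have h3 : V (K i) <-> U (K i).
    by rewrite eV; apply: flip_other.
  by rewrite W0 Wk in h1 h2; tauto.
apply: ji.
have hi := hK i ik; have := hK j jk; rewrite Kji => hj.
have iSk := ltnW ik; have jSk := ltnW jk.
case: hi hj => hi [hj|hj].
- by have [e1 e2] := same _ _ _ _ _ erefl (dW2 _ _ iSk jSk) hi hj; exact/esym/Winj.
- have [e1 e2] := same _ _ _ _ _ erefl (dW2 _ _ iSk jk) hi hj.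
  by have := Winj _ _ iSk jk e1; have := Winj _ _ ik jSk e2; lia.
- have [e1 e2] := same _ _ _ _ _ erefl (dW2 _ _ ik jSk) hi hj.
  by have := Winj _ _ ik jSk e1; have := Winj _ _ iSk jk e2; lia.
- have [e1 e2] := same _ _ _ _ _ erefl (dW2 _ _ ik jk) hi hj.
  exact/esym/Winj.
Qed.

End Orientations.
(** * Contraction of Voronoi cells *)

Lemma finite_set_inj (A B : Type) (f : A -> B) (F : set A) (D : set B) :
  finite_set D -> (forall x, F x -> D (f x)) ->
  (forall x y, F x -> F y -> f x = f y -> x = y) -> finite_set F.
Proof.
move=> fD FD inj; have [[x0 Fx0]|no] := pselect (F !=set0); last first.
  by apply: (sub_finite_set _ (finite_set0 _)) => x Fx; apply: no; exists x.
pose g b := if pselect (exists2 x, F x & f x = b) is left h then s2val (cid2 h) else x0.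
apply: (sub_finite_set _ (finite_image g fD)) => x Fx; exists (f x); first exact: FD.
rewrite /g; case: pselect => [h|]; last by case; exists x.
by case: (cid2 h) => y Fy fy /=; exact: inj.
Qed.

Lemma finite_least (A : choiceType) (lt : A -> A -> Prop) (F : set A) :
  (forall x y z, lt x y -> lt y z -> lt x z) ->
  (forall x y, x = y \/ lt x y \/ lt y x) ->
  finite_set F -> F !=set0 -> exists2 y, F y & forall z, F z -> z = y \/ lt y z.
Proof.
move=> tr tot /finite_seqP [s ->] [H0]; case: s => [|a s]; first by [].
move=> _; elim: s a => [|b s IH] a.
  by exists a; rewrite /= ?inE // => K; rewrite inE => /eqP; left.
have [y ys ymin] := IH b.
have [e|[ay|ya]] := tot a y.
- exists y; first by rewrite /= inE; apply/orP; right.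
  by move=> z; rewrite /= inE => /orP[/eqP->|/ymin //]; left.
- exists a; first by rewrite /= mem_head.
  move=> z; rewrite /= inE => /orP[/eqP->|/ymin[->|yz]]; [by left | by right|].
  by right; exact: tr yz.
- exists y; first by rewrite /= inE; apply/orP; right.
  by move=> z; rewrite /= inE => /orP[/eqP->|/ymin //]; right.
Qed.

Section ContractionDefs.
Context {X W : choiceType} (C : set X) (i : X -> W) (T : W -> W -> Prop)
  (lt : X -> X -> Prop).

(** [n] is the distance from [U] to the image of [C]; ties are broken by [lt], so that the cells
    partition the vertices. *)
Definition nearest U y : Prop :=
  C y /\ exists n, [/\ dle T n U (i y),
    forall z m, C z -> m < n -> ~ dle T m U (i z) &
    forall z, C z -> dle T n U (i z) -> z = y \/ lt y z].

Definition contracted_edge y z : Prop :=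
  y <> z /\ exists U V, [/\ T U V, nearest U y & nearest V z].

End ContractionDefs.

Section Contraction.
Context {X W : choiceType} (C : set X) (i : X -> W) (T : W -> W -> Prop)
  (lt : X -> X -> Prop) (M : set W).
Hypotheses (lt_irr : forall x, ~ lt x x)
  (lt_trans : forall x y z, lt x y -> lt y z -> lt x z)
  (lt_total : forall x y, x = y \/ lt x y \/ lt y x).
Hypotheses (C0 : C !=set0) (Ci : forall x, C x -> M (i x))
  (i_inj : forall x y, C x -> C y -> i x = i y -> x = y).
Hypotheses (Tsym : symm T) (TM : forall U V, T U V -> M V)
  (Tconn : forall U V, M U -> M V -> conn T U V)
  (Tfin : forall U, finite_set [set V | T U V]) (Tbr : bridges T).

Local Notation nearest := (nearest C i T lt).
Local Notation contracted_edge := (contracted_edge C i T lt).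

Lemma nearest_exists U : M U -> exists y, nearest U y.
Proof.
move=> MU; have [x Cx] := C0.
have [|n [[x1 [Cx1 hx1]] nmin]] := @nat_least (fun n => exists z, C z /\ dle T n U (i z)).
  by have [n hn] := Tconn MU (Ci Cx); exists n, x.
have fF : finite_set [set z | C z /\ dle T n U (i z)].
  apply: (finite_set_inj (f := i) (finite_dle n U Tfin)); first by move=> z [].
  by move=> y z [Cy _] [Cz _]; exact: i_inj.
have [|y [Cy hy] ymin] := finite_least lt_trans lt_total fF.
  by exists x1.
exists y; split=> //; exists n; split=> //.
  by move=> z m Cz mn hz; apply: (nmin m mn); exists z.
by move=> z Cz hz; apply: ymin.
Qed.

Lemma nearest_uniq U y z : nearest U y -> nearest U z -> y = z.
Proof.
move=> [Cy [n [n1 n2 n3]]] [Cz [m [m1 m2 m3]]].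
have [h|h|e] := ltngtP n m; first by case: (m2 y n Cy h).
  by case: (n2 z m Cz h).
subst m; have [//|yz] := n3 z Cz m1; have [//|zy] := m3 y Cy n1.
by case: (lt_irr (lt_trans yz zy)).
Qed.

Lemma nearest_center y : C y -> nearest (i y) y.
Proof.
move=> Cy; split=> //; exists 0; split=> // z Cz /= e; left.
exact: i_inj.
Qed.

(** On a shortest path from [U] to [i y] the next vertex has the same nearest point, as a better one
    for it would be better for [U] too. So cells are connected. *)
Lemma nearest_conn U y : nearest U y ->
  conn (restr T (fun V => nearest V y)) U (i y).
Proof.
move=> [Cy [n]]; elim: n U => [|n IH] U [n1 n2 n3].
  by rewrite -n1; exact: conn_refl.
have [V UV Vy] := dle_split n1 (erefl : (1 + n)%N = n.+1).
have TUV : T U V.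
  case: UV => [/= e|[z <- //]]; subst V.
  by case: (n2 y n Cy (ltnSn n)).
have hV : [/\ dle T n V (i y),
    forall z m, C z -> m < n -> ~ dle T m V (i z) &
    forall z, C z -> dle T n V (i z) -> z = y \/ lt y z].
  split=> // [z m Cz mn h|z Cz h].
    apply: (n2 z m.+1 Cz) => //; change (dle T (1 + m) U (i z)).
    exact: dle_trans (dle_edge _ TUV) h.
  apply: n3 => //; change (dle T (1 + n) U (i z)).
  exact: dle_trans (dle_edge _ TUV) h.
apply: conn_trans (IH V hV); apply: conn_edge; split=> //.
  by split=> //; exists n.+1.
by split=> //; exists n.
Qed.

Lemma contracted_symm : symm contracted_edge.
Proof.
move=> y z [yz [U [V [h1 h2 h3]]]]; split; first exact: nesym.
by exists V, U; split=> //; exact: Tsym.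
Qed.

Lemma contracted_class y z : contracted_edge y z -> C y /\ C z.
Proof. by move=> [_ [U [V [_ [Cy _] [Cz _]]]]]. Qed.

Lemma contracted_conn y z : C y -> C z -> conn contracted_edge y z.
Proof.
move=> Cy Cz.
have : forall V, conn T (i y) V -> M V /\ forall v, nearest V v -> conn contracted_edge y v.
  move=> V; apply: (@conn_ind _ _ (fun V => M V /\ forall v, nearest V v -> conn contracted_edge y v)).
    move=> A B AB [MA hA]; split; first exact: TM AB.
    move=> v hv; have [u hu] := nearest_exists MA.
    have := hA u hu; have [-> //|uv] := pselect (u = v).
    by move=> h; apply: (conn_trans h); apply: conn_edge; split=> //; exists A, B.
  split; first exact: Ci.
  by move=> v /(nearest_uniq (nearest_center Cy)) <-; exact: conn_refl.
move=> /(_ (i z) (Tconn (Ci Cy) (Ci Cz))) [_]; apply; exact: nearest_center.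
Qed.

(** A path of contracted edges lifts to the original graph through the connected cells. The edge
    from [U] to [V] joins two different cells, so it is used neither inside a cell nor by the lift
    of an edge other than the one between [y] and [z]. *)
Lemma contracted_bridges : bridges contracted_edge.
Proof.
move=> y z [yz [U [V [UV hU hV]]]] hc; apply: (Tbr UV).
set D := edge_del T U V.
have Dsym : symm D.
  by move=> A B [h1 h2 h3]; split; [exact: Tsym | tauto | tauto].
have fiber A a : nearest A a -> conn D A (i a).
  move=> /nearest_conn; apply: conn_sub => {}A B [AB hA hB]; split=> // -[e1 e2]; apply: yz.
    by rewrite (nearest_uniq hU (z := a)) -?e1 // (nearest_uniq hV (z := a)) -?e2.
  by rewrite (nearest_uniq hU (z := a)) -?e2 // (nearest_uniq hV (z := a)) -?e1.
have : conn D (i y) (i z).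
  apply: conn_lift hc => a b [[ab [A [B [AB hA hB]]]] n1 n2].
  apply: conn_trans (conn_sym Dsym (fiber _ _ hA)) _.
  apply: conn_trans (fiber _ _ hB); apply: conn_edge; split=> // -[e1 e2].
    by subst A B; apply: n1; split; [exact: nearest_uniq hA hU | exact: nearest_uniq hB hV].
  by subst A B; apply: n2; split; [exact: nearest_uniq hA hV | exact: nearest_uniq hB hU].
move=> h; apply: conn_trans (fiber _ _ hU) _; apply: (conn_trans h).
exact: conn_sym (fiber _ _ hV).
Qed.

End Contraction.
(** * Standard Borel spaces in the Cantor space *)

Definition npair (i j : nat) : nat := pickle (i, j).
Definition nunpair (n : nat) : nat * nat := odflt (0, 0) (unpickle n).

Lemma npairK i j : nunpair (npair i j) = (i, j).
Proof. by rewrite /nunpair /npair pickleK. Qed.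

Definition agree {A : Type} (m : nat) (a a' : nat -> A) : Prop :=
  forall i, i < m -> a i = a' i.

Lemma agree_leq (A : Type) m n (a a' : nat -> A) : m <= n -> agree n a a' -> agree m a a'.
Proof. by move=> mn h i im; apply: h; exact: leq_trans mn. Qed.

(** Closedness in the product of Cantor and Baire space: a pair outside is excluded by a finite part
    of its two sequences. *)
Definition closed_rel (Th : (nat -> bool) -> (nat -> nat) -> Prop) : Prop :=
  forall a s, ~ Th a s -> exists m, forall a' s', agree m a a' -> agree m s s' -> ~ Th a' s'.

Definition analytic (Z : Type) (phi : Z -> nat -> bool) (A : set Z) : Prop :=
  exists2 Th, closed_rel Th & forall z, A z <-> exists s, Th (phi z) s.

(* [bc_im] presents the image of [phi] as a countable intersection of open
   sets. *)
Record borel_code d (Z : measurableType d) (phi : Z -> nat -> bool)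
    (psi : nat -> nat -> (nat -> bool) -> Prop) : Prop := BorelCode {
  bc_meas : forall i, measurable [set z | phi z i];
  bc_inj : forall z z', phi z = phi z' -> z = z';
  bc_gen : forall D : set (set Z), sigma_algebra setT D ->
    (forall i, D [set z | phi z i]) -> forall A, measurable A -> D A;
  bc_fin : forall k l, exists m, forall a a', agree m a a' -> psi k l a -> psi k l a';
  bc_im : forall a, (exists z, phi z = a) <-> forall k, exists l, psi k l a }.

Section PolishCode.
Context (R : realType) (T : completePseudoMetricType R).
Hypotheses (Thaus : hausdorff_space T) (S : set T) (Scount : countable S) (Sdense : dense S).
Local Open Scope ring_scope.

Let e (k : nat) : R := k.+1%:R^-1.

Let e_gt0 k : 0 < e k. Proof. by rewrite invr_gt0. Qed.

Let e_small (eps : R) : 0 < eps -> exists k, e k < eps.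
Proof. by move=> /ltr_add_invr [k]; rewrite add0r; exists k. Qed.

Let e_le k m : (k <= m)%N -> e m <= e k.
Proof. by move=> km; rewrite lef_pV2 ?posrE ?ltr0n // ler_nat ltnS. Qed.

Let q_exists : exists q : nat -> T, forall t, S t -> exists i, q i = t.
Proof.
have /pcard_injP [f finj] := Scount.
exists (fun i => xget point [set s | S s /\ f s = i]) => t St; exists (f t).
case: xgetP => [y _ [Sy fy]|h]; last by case: (h t).
by apply: (finj y t) => //; rewrite inE.
Qed.

Let u := nunpair.
Let uE i j : u (npair i j) = (i, j). Proof. exact: npairK. Qed.

(** A point is coded by the basic open sets containing it, which are interiors of balls of radius
    [e k] around a dense sequence. Bits come from a point as soon as the sets they list behave like
    a regular filter with arbitrarily small members: by completeness the centres converge, and the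
    limit lies in exactly the listed sets. *)
Lemma polish_code : exists phi psi,
  @borel_code _ (g_sigma_algebraType (@open T)) phi psi.
Proof.
have [q hq] := q_exists.
pose O i : set T := (ball (q (u i).1) (e (u i).2))°.
have Osub i : O i `<=` ball (q (u i).1) (e (u i).2) by exact: interior_subset.
have Oopen i : open (O i) by exact: open_interior.
have cover t k : exists j, O (npair j k) t.
  have e2 : 0 < e k / 2 by rewrite divr_gt0.
  have [|s [ts Ss]] := Sdense _ (open_interior (ball t (e k / 2))).
    by exists t; apply: nbhsx_ballx.
  have [j qj] := hq s Ss; exists j; rewrite /O uE /= qj.
  apply: (@filterS _ (nbhs t) _ (ball t (e k / 2))); last exact: nbhsx_ballx.
  move=> y ty.
  have st : ball s (e k / 2) t by apply: ball_sym; exact: interior_subset ts.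
  by have := ball_triangle st ty; rewrite -splitr.
(* The factor 8 leaves room for every triangle inequality below; the largest multiple of [e k] that
   occurs is 5. *)
have small (eps : R) : 0 < eps -> exists k, 8 * e k < eps.
  move=> eps0; have [|k hk] := @e_small (eps / 8); first by rewrite divr_gt0.
  by exists k; rewrite mulrC -ltr_pdivlMr.
pose phi (t : g_sigma_algebraType (@open T)) i := `[< O i t >].
(* [K] codes a tag and a pair [(i, j)]. The tags ask for listed sets of every radius, for pairwise
   intersections, for a listed ball whose enlargement lies inside a given listed set, and for
   closure under supersets. The enlargement by 4 keeps the limit of the centres inside the given
   set. *)
pose psi K l (a : nat -> bool) : Prop :=
  let: (i, j) := nunpair (nunpair K).2 in
  match (nunpair K).1 with
  | 0 => a (npair l i)
  | 1 => a i -> a j -> O i `&` O j !=set0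
  | 2 => a i -> a l /\ ball (q (u l).1) (4 * e (u l).2) `<=` O i
  | _ => a j -> O j `<=` O i -> a i
  end%N.
have psiP a : (forall k, exists l, psi k l a) ->
  [/\ forall k, exists j, a (npair j k),
      forall i j, a i -> a j -> O i `&` O j !=set0,
      forall i, a i -> exists l, a l /\ ball (q (u l).1) (4 * e (u l).2) `<=` O i &
      forall i j, a j -> O j `<=` O i -> a i].
  move=> h; split.
  - by move=> k; have [l] := h (npair 0 (npair k 0)); rewrite /psi !npairK /=; exists l.
  - by move=> i j; have [l] := h (npair 1 (npair i j)); rewrite /psi !npairK /=.
  - move=> i ai; have [l] := h (npair 2 (npair i 0)); rewrite /psi !npairK /= => /(_ ai).
    by exists l.
  - by move=> i j; have [l] := h (npair 3 (npair i j)); rewrite /psi !npairK /=.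
exists phi, psi; split.
- move=> i; rewrite (_ : [set _ | _] = O i); last first.
    by apply/seteqP; split=> t /asboolP.
  exact: sub_sigma_algebra.
- move=> t t' tt'; apply/eqP; apply: contrapT => /negP ne.
  move: (Thaus); rewrite ball_hausdorff => /(_ _ _ ne) [[r1 r2]] /= /eqP dis.
  have [k hk] := small r1%:num [gt0 of r1%:num].
  have [j hj] := cover t k.
  have : phi t (npair j k) by exact/asboolP.
  rewrite tt' => /asboolP /Osub; move: hj => /Osub; rewrite uE /= => h1 h2.
  suff : (ball t r1%:num `&` ball t' r2%:num) t' by rewrite dis.
  split; last exact: ball_center.
  apply: le_ball (ball_triangle (ball_sym h1) h2).
  by have := e_gt0 k; lra.
- move=> D [D0 DC Dbig] DO A mA; apply: (smallest_sub _ _ mA) => // B oB.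
  have -> : B = \bigcup_i (if `[< O i `<=` B >] then O i else set0).
    apply/seteqP; split=> [t Bt|t [i _]]; last first.
      by case: ifP => [/asboolP|_ []]; apply.
    have : nbhs t B by exact: open_nbhs_nbhs.
    move=> /nbhs_ballP [eps /= eps0 hB].
    have [k hk] := small eps eps0; have [j hj] := cover t k.
    exists (npair j k) => //; case: ifP => // /asboolP; case=> y /Osub hy.
    move: hj => /Osub; rewrite uE /= => h1; apply: hB; rewrite uE /= in hy.
    apply: le_ball (ball_triangle (ball_sym h1) hy).
    by have := e_gt0 k; lra.
  apply: Dbig => i; case: ifP => // _; rewrite (_ : O i = [set z | phi z i]) //.
  by apply/seteqP; split=> t /asboolP.
- move=> K l; rewrite /psi.
  case: (nunpair (nunpair K).2) => i j.
  exists (npair l i + i + j + l).+1%N => a a' aa'.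
  have ai : a i = a' i by apply: aa'; lia.
  have aj : a j = a' j by apply: aa'; lia.
  have al : a l = a' l by apply: aa'; lia.
  have ap : a (npair l i) = a' (npair l i) by apply: aa'; lia.
  by rewrite ai aj al ap.
- move=> a; split=> [[t <-] K|/psiP [h1 h2 h3 h4]].
    rewrite /psi; case: (nunpair (nunpair K).2) => i j.
    case: (nunpair K).1 => [|[|[|tag]]].
    + by have [l hl] := cover t i; exists l; exact/asboolP.
    + by exists 0%N => /asboolP h1 /asboolP h2; exists t.
    + have [/asboolP Ot|nO] := boolP (phi t i); last by exists 0%N.
      have : nbhs t (O i) by exact: open_nbhs_nbhs.
      move=> /nbhs_ballP [eps /= eps0 hB].
      have [k hk] := small eps eps0; have [l hl] := cover t k.
      exists (npair l k) => _; split; first exact/asboolP.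
      move: hl => /Osub; rewrite !uE /= => hl y hy; apply: hB.
      apply: le_ball (ball_triangle (ball_sym hl) hy).
      by have := e_gt0 k; lra.
    + by exists 0%N => /asboolP h1 h2; apply/asboolP; exact: h2.
  have [j hj] := choice h1.
  pose p k := q (j k).
  have pp i k : a i -> ball (q (u i).1) (e (u i).2 + e k) (p k).
    move=> ai; have [y [/Osub yi /Osub yk]] := h2 _ _ ai (hj k).
    by rewrite uE /= in yk; exact: ball_triangle yi (ball_sym yk).
  have ppk k m : ball (p k) (e k + e m) (p m).
    by have := pp _ m (hj k); rewrite uE.
  have cF : cauchy (p @ \oo).
    apply: cauchy_exP => eps eps0; have [K hK] := small eps eps0.
    exists (p K); exists K => // m /= Km; apply: le_ball (ppk K m).
    by have := e_le Km; have := e_gt0 K; lra.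
  have /cvg_ex [x px] : cvg (p @ \oo) by exact: cauchy_cvg.
  have limb k : ball (p k) (3 * e k) x.
    have /(px _) [N _ hN] := nbhsx_ballx x _ (e_gt0 k).
    have h := hN (maxn N k) (leq_maxl _ _).
    apply: le_ball (ball_triangle (ppk k (maxn N k)) (ball_sym h)).
    by have := e_le (leq_maxr N k); lra.
  exists x; apply/funext => i; apply/idP/idP => [/asboolP Ox|ai].
    have : nbhs x (O i) by exact: open_nbhs_nbhs.
    move=> /nbhs_ballP [eps /= eps0 hB].
    have [k hk] := small eps eps0.
    apply: (h4 i _ (hj k)) => y /Osub; rewrite uE /= => hy; apply: hB.
    apply: le_ball (ball_triangle (ball_sym (limb k)) hy).
    by have := e_gt0 k; lra.
  apply/asboolP; have [l [al]] := h3 i ai; apply.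
  have [m hm] := small _ (e_gt0 (u l).2).
  apply: le_ball (ball_triangle (pp _ m al) (limb m)).
  by have := e_gt0 (u l).2; have := e_gt0 m; lra.
Qed.

End PolishCode.

Lemma standard_borel_code (R : realType) d (X : measurableType d) :
  standard_borel R X -> exists phi psi, @borel_code _ X phi psi.
Proof.
move=> [T [hT [S cS dS] [f [g [fK gK mf mg]]]]].
have [phi [psi [c1 c2 c3 c4 c5]]] := polish_code hT cS dS.
exists (phi \o f), psi; split.
- by move=> i; have := mf measurableT _ (c1 i); rewrite setTI.
- by move=> z z' /c2 /(can_inj fK).
- move=> D [D0 DC Dbig] DO A mA.
  have -> : A = f @^-1` (g @^-1` A).
    by apply/seteqP; split=> x; rewrite /preimage /= fK.
  apply: (c3 [set B | D (f @^-1` B)]) => //; last first.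
    by have := mg measurableT _ mA; rewrite setTI.
  split=> /=; first by rewrite preimage_set0.
    by move=> B DB; rewrite setTD preimage_setC -setTD; exact: DC.
  by move=> F DF; rewrite preimage_bigcup; exact: Dbig.
- exact: c4.
- move=> a; rewrite -c5; split=> -[z hz]; first by exists (f z).
  by exists (g z); rewrite /= gK.
Qed.
(** * Analytic sets and the Lusin-Novikov theorem *)

Section Analytic.
Context (Z : Type) (phi : Z -> nat -> bool).

Lemma analytic_coord i b : analytic phi [set z | phi z i = b].
Proof.
exists (fun a _ => a i = b); last by move=> z; split=> [h|[_ //]]; exists id.
by move=> a s h; exists i.+1 => a' s' e _ h'; apply: h; rewrite e.
Qed.

Lemma analytic_bigcup (A : nat -> set Z) : (forall n, analytic phi (A n)) ->
  analytic phi (\bigcup_n A n).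
Proof.
move=> hA.
have /choice [Th hTh] : forall n, exists Th, closed_rel Th /\
    forall z, A n z <-> exists s, Th (phi z) s.
  by move=> n; have [Th h1 h2] := hA n; exists Th.
exists (fun a s => Th (s 0) a (fun j => s j.+1)).
  move=> a s /((hTh (s 0)).1 a _) [m hm]; exists m.+1 => a' s' ea es.
  rewrite -(es 0) //; apply: hm; first exact: agree_leq ea.
  by move=> i im; apply: es.
move=> z; split=> [[n _ /(hTh n).2 [s hs]]|[s hs]].
  by exists (fun j => if j is i.+1 then s i else n).
by exists (s 0) => //; apply/(hTh (s 0)).2; exists (fun j => s j.+1).
Qed.

(** One sequence carries the witnesses for all [n] along the pairing; its modulus has to reach the
    positions of the first [m] terms of the witness in question. *)
Lemma analytic_bigcap (A : nat -> set Z) : (forall n, analytic phi (A n)) ->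
  analytic phi (\bigcap_n A n).
Proof.
move=> hA.
have /choice [Th hTh] : forall n, exists Th, closed_rel Th /\
    forall z, A n z <-> exists s, Th (phi z) s.
  by move=> n; have [Th h1 h2] := hA n; exists Th.
exists (fun a s => forall n, Th n a (fun j => s (npair n j))).
  move=> a s /existsNP [n /((hTh n).1 a _) [m hm]].
  exists (m + \max_(j < m) (npair n j).+1)%N => a' s' ea es h.
  apply: (hm _ _ _ _ (h n)); first by apply: agree_leq ea; exact: leq_addr.
  move=> i im; apply: es.
  have := @leq_bigmax _ (fun j : 'I_m => (npair n j).+1) (Ordinal im).
  by move=> /= h1; apply: leq_trans h1 _; exact: leq_addl.
move=> z; split=> [Az|[s hs] n _]; last first.
  by apply/(hTh n).2; exists (fun j => s (npair n j)).
have /choice [s hs] : forall n, exists s, Th n (phi z) s.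
  by move=> n; apply/(hTh n).2; exact: Az.
exists (fun k => s (nunpair k).1 (nunpair k).2) => n.
by under eq_fun do rewrite npairK /=; exact: hs.
Qed.

Lemma analytic_ext (A B : set Z) : (forall z, A z <-> B z) -> analytic phi A -> analytic phi B.
Proof.
by move=> AB [Th h1 h2]; exists Th => // z; rewrite -AB.
Qed.

End Analytic.

(** The sets that are analytic together with their complements form a sigma-algebra containing the
    coordinate sets. *)
Lemma measurable_analytic d (Z : measurableType d) phi psi (A : set Z) :
  borel_code phi psi -> measurable A -> analytic phi A.
Proof.
move=> bc mA; suff [] : analytic phi A /\ analytic phi (~` A) by [].
apply: (bc_gen bc (D := [set A | analytic phi A /\ analytic phi (~` A)])) mA.
  split=> /=.
  - split.
      exists (fun _ _ => False); last by move=> z; split=> [//|[]].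
      by move=> a s _; exists 0 => a' s' _ _ [].
    exists (fun _ _ => True) => [a s []//|z].
    by split=> [_|_ //]; exists id.
  - by move=> B [h1 h2]; rewrite setTD setCK.
  - move=> F hF; split; first by apply: analytic_bigcup => n; exact: (hF n).1.
    by rewrite setC_bigcup; apply: analytic_bigcap => n; exact: (hF n).2.
move=> i; split; first exact: analytic_coord.
apply: analytic_ext (analytic_coord phi i false) => z /=.
by split=> [-> //|/negP/negbTE].
Qed.

Section Image.
Context d (Z : measurableType d) (phi : Z -> nat -> bool) (psi : nat -> nat -> (nat -> bool) -> Prop).
Hypothesis bc : borel_code phi psi.

(** The choices of [l] for all [k] in [bc_im] become one witness sequence, so the image of [phi] is
    analytic in Cantor space. *)
Lemma image_closed_rel : exists2 Th, closed_rel Th &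
  forall a, (exists z, phi z = a) <-> exists s, Th a s.
Proof.
exists (fun a s => forall k, psi k (s k) a).
  move=> a s /existsNP [k hk]; have [m hm] := bc_fin bc k (s k).
  exists (m + k.+1) => a' s' ea es h; apply: hk.
  have sk : s k = s' k by apply: es; lia.
  apply: (hm a'); last by rewrite sk; exact: h.
  by move=> i im; apply/esym/ea; lia.
by move=> a; rewrite (bc_im bc); split=> [/choice [s hs]|[s hs] k]; [exists s | exists (s k)].
Qed.

End Image.

Definition interleave {A : Type} (a b : nat -> A) (n : nat) : A :=
  if odd n then b n./2 else a n./2.

Lemma interleave_even (A : Type) (a b : nat -> A) n : interleave a b n.*2 = a n.
Proof. by rewrite /interleave odd_double doubleK. Qed.

Lemma interleave_odd (A : Type) (a b : nat -> A) n : interleave a b n.*2.+1 = b n.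
Proof. by rewrite /interleave /= odd_double uphalf_double. Qed.

Lemma agree_interleave (A : Type) m (a b a' b' : nat -> A) :
  agree m a a' -> agree m b b' -> agree m (interleave a b) (interleave a' b').
Proof.
move=> ea eb i im; rewrite /interleave.
have im2 : i./2 < m by have := leq_half_double i i; have := half_double i; lia.
by case: ifP => _; [exact: eb | exact: ea].
Qed.

Section ProductCode.
Context d1 d2 (Z : measurableType d1) (X : measurableType d2).
Context (phiZ : Z -> nat -> bool) (psiZ : nat -> nat -> (nat -> bool) -> Prop).
Context (phiX : X -> nat -> bool) (psiX : nat -> nat -> (nat -> bool) -> Prop).
Hypotheses (bcZ : borel_code phiZ psiZ) (bcX : borel_code phiX psiX).

Definition prod_phi (p : Z * X) := interleave (phiZ p.1) (phiX p.2).

Definition prod_psi k l (a : nat -> bool) : Prop :=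
  if odd k then psiX k./2 l (fun i => a i.*2.+1) else psiZ k./2 l (fun i => a i.*2).

Lemma prod_borel_code : borel_code prod_phi prod_psi.
Proof.
split.
- move=> i; rewrite /prod_phi /interleave; case: (odd i).
    rewrite (_ : [set _ | _] = setT `*` [set x | phiX x i./2]).
      by apply: measurableX => //; exact: bc_meas bcX _.
    by apply/seteqP; split=> -[z x] //= [].
  rewrite (_ : [set _ | _] = [set z | phiZ z i./2] `*` setT).
    by apply: measurableX => //; exact: bc_meas bcZ _.
  by apply/seteqP; split=> -[z x] //= [].
- move=> [z x] [z' x'] h; congr pair.
    apply: (bc_inj bcZ); apply/funext => i.
    by have := congr1 (fun f => f i.*2) h; rewrite /prod_phi !interleave_even.
  apply: (bc_inj bcX); apply/funext => i.
  by have := congr1 (fun f => f i.*2.+1) h; rewrite /prod_phi !interleave_odd.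
- move=> D sD DO A mA.
  have [D0 DC Dbig] := sD.
  apply: (smallest_sub sD _ mA) => B [] [C mC <-]; rewrite setTI.
    apply: (bc_gen bcZ (D := [set C | D (fst @^-1` C)])) mC.
      split=> /=; first by rewrite preimage_set0.
        by move=> F DF; rewrite setTD preimage_setC -setTD; exact: DC.
      by move=> F DF; rewrite preimage_bigcup; exact: Dbig.
    move=> i /=; rewrite (_ : _ @^-1` _ = [set p | prod_phi p i.*2]) //.
    by apply/seteqP; split=> p /=; rewrite /prod_phi interleave_even.
  apply: (bc_gen bcX (D := [set C | D (snd @^-1` C)])) mC.
    split=> /=; first by rewrite preimage_set0.
      by move=> F DF; rewrite setTD preimage_setC -setTD; exact: DC.
    by move=> F DF; rewrite preimage_bigcup; exact: Dbig.
  move=> i /=; rewrite (_ : _ @^-1` _ = [set p | prod_phi p i.*2.+1]) //.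
  by apply/seteqP; split=> p /=; rewrite /prod_phi interleave_odd.
- move=> k l; rewrite /prod_psi; case: (odd k).
    have [m hm] := bc_fin bcX k./2 l; exists m.*2.+1 => a a' e.
    by apply: hm => i im; apply: e; lia.
  have [m hm] := bc_fin bcZ k./2 l; exists m.*2.+1 => a a' e.
  by apply: hm => i im; apply: e; lia.
- move=> a; split.
    move=> [[z x] <-] k; rewrite /prod_psi /prod_phi.
    case: (odd k).
      have -> : (fun i => interleave (phiZ (z, x).1) (phiX (z, x).2) i.*2.+1) = phiX x.
        by apply/funext => i; rewrite interleave_odd.
      by apply: (bc_im bcX (phiX x)).1; exists x.
    have -> : (fun i => interleave (phiZ (z, x).1) (phiX (z, x).2) i.*2) = phiZ z.
      by apply/funext => i; rewrite interleave_even.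
    by apply: (bc_im bcZ (phiZ z)).1; exists z.
  move=> h.
  have [|z hz] := (bc_im bcZ (fun i => a i.*2)).2.
    by move=> k; have [l] := h k.*2; rewrite /prod_psi odd_double doubleK; exists l.
  have [|x hx] := (bc_im bcX (fun i => a i.*2.+1)).2.
    by move=> k; have [l] := h k.*2.+1; rewrite /prod_psi /= odd_double uphalf_double; exists l.
  exists (z, x); apply/funext => i; rewrite /prod_phi /interleave /= hz hx.
  have := odd_double_half i; case: ifP => _ {2}<- //=.
Qed.

(** The witness interleaves the code of the point that is projected away, a witness for [A], and a
    witness that this code does come from a point. Bits are read from numbers by testing
    positivity. *)
Lemma analytic_proj (A : set (Z * X)) : analytic prod_phi A ->
  analytic phiZ [set z | exists x, A (z, x)].
Proof.
move=> [Th hc hTh]; have [Im ic hIm] := image_closed_rel bcX.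
pose b (s : nat -> nat) i := 0 < s i.*2.
pose s1 (s : nat -> nat) i := s i.*2.*2.+1.
pose s2 (s : nat -> nat) i := s i.*2.+1.*2.+1.
have agb m s s' : agree m.*2.*2.+4 s s' ->
    [/\ agree m (b s) (b s'), agree m (s1 s) (s1 s') & agree m (s2 s) (s2 s')].
  by move=> e; split=> i im; rewrite /b /s1 /s2 e //; lia.
exists (fun a s => Th (interleave a (b s)) (s1 s) /\ Im (b s) (s2 s)).
  move=> a s /not_andP [/hc|/ic] [m hm]; exists m.*2.*2.+4 => a' s' ea /agb [e1 e2 e3] [h1 h2].
    apply: (hm _ _ _ _ h1) => //; apply: agree_interleave => //.
    by apply: agree_leq ea; lia.
  exact: (hm _ _ _ _ h2).
move=> z; split.
  move=> [x /hTh [t ht]]; have [s hs] := (hIm (phiX x)).1 (ex_intro _ x erefl).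
  exists (interleave (fun i => phiX x i : nat) (interleave t s)).
  have -> : b (interleave (fun i => phiX x i : nat) (interleave t s)) = phiX x.
    by apply/funext => i; rewrite /b interleave_even; case: (phiX x i).
  split.
    have -> : s1 (interleave (fun i => phiX x i : nat) (interleave t s)) = t.
      by apply/funext => i; rewrite /s1 interleave_odd interleave_even.
    exact: ht.
  have -> : s2 (interleave (fun i => phiX x i : nat) (interleave t s)) = s.
    by apply/funext => i; rewrite /s2 !interleave_odd.
  exact: hs.
move=> [s [h1 h2]]; have [x hx] := (hIm (b s)).2 (ex_intro _ _ h2).
exists x; apply/hTh; exists (s1 s); rewrite /prod_phi /= hx.
exact: h1.
Qed.

End ProductCode.

Lemma dependent_choice_prefix (A : Type) (P : seq A -> Prop) : P [::] ->
  (forall l, P l -> exists x, P (rcons l x)) ->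
  exists u : nat -> A, forall k, P (mkseq u k).
Proof.
move=> P0 step.
have [x0 _] := step _ P0.
have /choice [g hg] : forall l, exists x, P l -> P (rcons l x).
  by move=> l; have [/step [x hx]|h] := pselect (P l); [exists x | exists x0].
pose st k := iter k (fun l => rcons l (g l)) [::].
exists (fun k => g (st k)) => k.
have -> : mkseq (fun k => g (st k)) k = st k.
  by elim: k => [//|k IH]; rewrite mkseqS IH.
by elim: k => [//|k IH]; exact: hg.
Qed.

Section Novikov.
Context d (Z : measurableType d) (phi : Z -> nat -> bool) (psi : nat -> nat -> (nat -> bool) -> Prop).
Hypothesis bc : borel_code phi psi.

Definition separable_family (F : nat -> set Z) : Prop :=
  exists B : nat -> set Z, [/\ forall n, measurable (B n),
    forall n, F n `<=` B n & \bigcap_n B n = set0].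

(** The separating sets of the pieces are combined by a union at [n0] and by intersections
    elsewhere; a point common to all would be common to those of a single [v]. *)
Lemma separable_split n0 (F : nat -> set Z) (G : nat -> nat -> set Z) :
  (forall z, F n0 z -> exists v, G v n0 z) ->
  (forall v n, n <> n0 -> F n `<=` G v n) ->
  (forall v, separable_family (G v)) -> separable_family F.
Proof.
move=> h1 h2 /choice [B hB].
exists (fun n => if n == n0 then \bigcup_v B v n else \bigcap_v B v n); split.
- move=> n; case: eqP => _; first by apply: bigcup_measurable => v _; case: (hB v).
  by apply: bigcap_measurable => // v _; case: (hB v).
- move=> n z Fz; case: eqP => [e|ne].
    subst n; have [v Gz] := h1 z Fz; exists v => //; case: (hB v) => _ h _; exact: h.
  move=> v _; case: (hB v) => _ h _; apply: h; exact: (h2 v n ne).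
- rewrite -subset0 => z hz; have := hz n0 I; rewrite eqxx => -[v _ Bz].
  have [_ _ <-] := hB v; move=> n _; have := hz n I.
  by case: eqP => [->|_ h]; [|exact: h].
Qed.

Lemma separable_bit k (F : nat -> set Z) :
  (forall b, separable_family (fun n => F n `&` [set z | phi z k = b])) ->
  separable_family F.
Proof.
move=> h; have [B [mB BF B0]] := h true; have [B' [mB' BF' B0']] := h false.
have mk := bc_meas bc k.
exists (fun n => (B n `&` [set z | phi z k]) `|` (B' n `&` ~` [set z | phi z k])); split.
- by move=> n; apply: measurableU; apply: measurableI => //; exact: measurableC.
- move=> n z Fz; have [e|e] := boolP (phi z k); [left|right]; split=> //.
    exact: BF.
    by apply: BF'; split=> //; exact/negbTE.
    by move=> /= h1; rewrite h1 in e.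
- rewrite -subset0 => z hz; have [e|e] := boolP (phi z k).
    by rewrite -B0 => n _; have [[]|[_]] := hz n I.
  by rewrite -B0' => n _; have [[_ h1]|[]] := hz n I => //; rewrite h1 in e.
Qed.

Lemma separable_trivial n0 (F : nat -> set Z) : F n0 = set0 -> separable_family F.
Proof.
move=> h; exists (fun n => if n == n0 then set0 else setT); split.
- by move=> n; case: eqP.
- by move=> n; case: eqP => // ->; rewrite h.
- by rewrite -subset0 => z /(_ n0 I); rewrite eqxx.
Qed.

(* Novikov's separation theorem: if the sets are not separable, then bits of a
   common point and of the witnesses can be chosen one at a time so that the
   restricted sets stay non-separable. *)
Lemma novikov_separation (A : nat -> set Z) : (forall n, analytic phi (A n)) ->
  \bigcap_n A n = set0 -> separable_family A.
Proof.
move=> hA A0; apply: contrapT => nsep.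
have [Im ic hIm] := image_closed_rel bc.
have /choice [Th hTh] : forall n, exists Th, closed_rel Th /\
    forall z, A n z <-> exists s, Th (phi z) s.
  by move=> n; have [Th h1 h2] := hA n; exists Th.
(* Index 0 is given to the image of [phi], so that the bits found in the limit are the code of a
   point. *)
pose Th' n := if n is m.+1 then Th m else Im.
have cTh' n : closed_rel (Th' n) by case: n => [|n] //; exact: (hTh n).1.
pose x0 := (false, 0).
(* Step [k] fixes bit [k] of the point and, if [k] is [npair n i], the value at [i] of the witness
   for the set [n]. *)
pose F (l : seq (bool * nat)) n : set Z := [set z |
  (forall i, i < size l -> phi z i = (nth x0 l i).1) /\
  exists t, (forall i, npair n i < size l -> t i = (nth x0 l (npair n i)).2) /\
            Th' n (phi z) t].
have [||u hu] := @dependent_choice_prefix _ (fun l => ~ separable_family (F l)).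
- move=> [B [mB BF B0]]; apply: nsep; exists (fun n => B n.+1); split=> //.
    move=> n z /(hTh n).2 [s hs]; apply: BF; split=> //.
    by exists s.
  rewrite -subset0 => z hz; rewrite -B0 => -[|n] _; last exact: hz.
  apply: BF; split=> //; have [s hs] := (hIm (phi z)).1 (ex_intro _ z erefl).
  by exists s.
- move=> l nl; apply: contrapT => no; apply: nl.
  apply: (@separable_bit (size l)) => b.
  pose k := size l.
  apply: (@separable_split (nunpair k).1 _ (fun v => F (rcons l (b, v)))).
  + move=> z [[h1 [t [h2 h3]]] hb].
    exists (t (nunpair k).2); split.
      move=> i; rewrite size_rcons ltnS leq_eqVlt nth_rcons => /orP[/eqP->|il].
        by rewrite ltnn eqxx.
      by rewrite il; exact: h1.
    exists t; split=> // i; rewrite size_rcons ltnS leq_eqVlt nth_rcons => /orP[/eqP e|il].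
      by rewrite e ltnn eqxx /k -e npairK.
    by rewrite il; exact: h2.
  + move=> v n ne z [[h1 [t [h2 h3]]] hb]; split.
      move=> i; rewrite size_rcons ltnS leq_eqVlt nth_rcons => /orP[/eqP->|il].
        by rewrite ltnn eqxx.
      by rewrite il; exact: h1.
    exists t; split=> // i; rewrite size_rcons ltnS leq_eqVlt nth_rcons => /orP[/eqP e|il].
      by case: ne; rewrite /k -e npairK.
    by rewrite il; exact: h2.
  + by move=> v; apply: contrapT => nv; apply: no; exists (b, v).
pose a i := (u i).1; pose t n i := (u (npair n i)).2.
(* By closedness a failure shows on a finite prefix; there one set of the family is empty, and the
   family is trivially separable. *)
have key n : Th' n a (t n).
  apply: contrapT => /cTh' [m hm].
  pose k := (m + \max_(j < m) (npair n j).+1)%N.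
  apply: (hu k); apply: (@separable_trivial n).
  rewrite -subset0 => z [h1 [s [h2 h3]]]; apply: (hm (phi z) s) => //.
    move=> i im; rewrite h1 ?size_mkseq ?nth_mkseq //; rewrite /k; lia.
  move=> i im.
  have ik : npair n i < k.
    have := @leq_bigmax _ (fun j : 'I_m => (npair n j).+1) (Ordinal im).
    by move=> /= h; apply: leq_trans h _; exact: leq_addl.
  by rewrite h2 ?size_mkseq ?nth_mkseq.
have [z hz] := (hIm a).2 (ex_intro _ _ (key 0)).
have : (\bigcap_n A n) z.
  by move=> n _; apply/(hTh n).2; exists (t n.+1); rewrite hz; exact: (key n.+1).
by rewrite A0.
Qed.

Lemma lusin_separation (A B : set Z) : analytic phi A -> analytic phi B ->
  A `&` B = set0 -> exists2 D, measurable D & A `<=` D /\ B `<=` ~` D.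
Proof.
move=> hA hB AB.
have [||D [mD DF D0]] := @novikov_separation (fun n => if n is 0 then A else B).
- by case.
- by rewrite -subset0 => z h; rewrite -AB; split; [exact: (h 0) | exact: (h 1)].
exists (D 0) => //; split=> [|z Bz Dz]; first exact: (DF 0).
by rewrite -[False]/(set0 z) -D0 => -[|n] _ //; exact: (DF n.+1).
Qed.

End Novikov.

Lemma measurable_finitary d (Z : measurableType d) (al : Z -> nat -> bool) m
    (P : (nat -> bool) -> Prop) :
  (forall i, measurable [set z | al z i]) ->
  (forall a a', agree m a a' -> P a -> P a') -> measurable [set z | P (al z)].
Proof.
move=> mal; elim: m P => [|m IH] P hP.
  have [Pt|Pf] := pselect (P (fun=> true)).
    rewrite (_ : [set _ | _] = setT) //; apply/seteqP; split=> // z _ /=.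
    exact: hP Pt.
  rewrite (_ : [set _ | _] = set0) //; apply/seteqP; split=> // z /= Pz.
  by apply: Pf; exact: hP Pz.
pose Q b a := P (fun i => if i == m then b else a i).
have mQ b : measurable [set z | Q b (al z)].
  apply: IH => a a' e; apply: hP => i; rewrite ltnS leq_eqVlt.
  by case: eqP => //= _ im; rewrite e.
have QE z : P (al z) <-> Q (al z m) (al z).
  by split; apply: hP => i _; case: eqP => // ->.
rewrite (_ : [set _ | _] = ([set z | al z m] `&` [set z | Q true (al z)]) `|`
  (~` [set z | al z m] `&` [set z | Q false (al z)])).
  by apply: measurableU; apply: measurableI => //; exact: measurableC.
apply/seteqP; split=> z /=.
  by move/QE; have [|] := boolP (al z m) => h hQ; [left | right; split=> //; exact/negP].
by move=> [[h hQ]|[/negP/negbTE h hQ]]; apply/QE; rewrite h.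
Qed.

Definition cylinder {Z : Type} (phi : Z -> nat -> bool) (s : seq (nat * bool)) : set Z :=
  [set z | all (fun p => phi z p.1 == p.2) s].

Section Uniformization.
Context d (X : measurableType d) (phi : X -> nat -> bool) (psi : nat -> nat -> (nat -> bool) -> Prop).
Hypothesis bc : borel_code phi psi.

Lemma measurable_fun_code d' (Z : measurableType d') (g : Z -> X) :
  (forall i, measurable [set z | phi (g z) i]) -> measurable_fun setT g.
Proof.
move=> mg _ A mA; rewrite setTI.
apply: (bc_gen bc (D := [set A | measurable (g @^-1` A)])) mA => //.
split=> /=; first by rewrite preimage_set0.
  by move=> F DF; rewrite setTD preimage_setC; exact: measurableC.
by move=> F DF; rewrite preimage_bigcup; exact: bigcup_measurable.
Qed.

Lemma measurable_cylinder s : measurable (cylinder phi s).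
Proof.
rewrite /cylinder; elim: s => [|[i b] s IH] /=.
  by rewrite (_ : [set _ | _] = setT) //; apply/seteqP; split.
rewrite (_ : [set _ | _] = [set z | phi z i == b] `&` [set z | all (fun p => phi z p.1 == p.2) s]).
  apply: measurableI => //; case: b.
    rewrite (_ : [set _ | _] = [set z | phi z i]); first exact: bc_meas bc i.
    by apply/seteqP; split=> z /=; rewrite eqb_id.
  rewrite (_ : [set _ | _] = ~` [set z | phi z i]); first exact/measurableC/(bc_meas bc i).
  by apply/seteqP; split=> z /=; rewrite eqbF_neg => /negP.
by apply/seteqP; split=> z /= /andP.
Qed.

Lemma cylinder_isolates y (F : set X) : finite_set F ->
  exists s, cylinder phi s y /\ forall z, F z -> cylinder phi s z -> z = y.
Proof.
move=> /finite_seqP [t ->]; elim: t => [|z t [s [ys hs]]]; first by exists [::].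
have [e|zy] := pselect (z = y).
  exists s; split=> // w; rewrite /= inE => /orP[/eqP -> //|]; exact: hs.
have [i hi] : exists i, phi z i <> phi y i.
  apply: contrapT => no; apply: zy; apply: (bc_inj bc); apply/funext => i.
  by apply: contrapT => h; apply: no; exists i.
exists ((i, phi y i) :: s); split; first by rewrite /cylinder /= eqxx.
move=> w; rewrite /= inE /cylinder /= => /orP[/eqP ->|wt] /andP[/eqP h1 h2].
  by case: hi.
exact: hs.
Qed.

Lemma measurable_diag d' (Z : measurableType d') (f g : Z -> X) :
  measurable_fun setT f -> measurable_fun setT g -> measurable [set z | f z = g z].
Proof.
move=> mf mg.
rewrite (_ : [set _ | _] = \bigcap_i ([set z | phi (f z) i] `&` [set z | phi (g z) i] `|`
   (~` [set z | phi (f z) i] `&` ~` [set z | phi (g z) i]))).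
  have mfi i : measurable [set z | phi (f z) i].
    by have := mf measurableT _ (bc_meas bc i); rewrite setTI.
  have mgi i : measurable [set z | phi (g z) i].
    by have := mg measurableT _ (bc_meas bc i); rewrite setTI.
  apply: bigcap_measurable => // i _.
  by apply: measurableU; apply: measurableI => //; exact: measurableC.
apply/seteqP; split=> z /=.
  move=> e i _; have {}e : phi (f z) i = phi (g z) i by rewrite e.
  by have [c|/negP c] := boolP (phi (g z) i); [left | right]; split; rewrite /= ?e.
move=> h; apply: (bc_inj bc); apply/funext => i.
by have [[/= -> ->]|[/= /negP/negbTE-> /negP/negbTE->]] := h i I.
Qed.

(** Over the domain of [C], bit [i] of the value at [x] is decided by a Borel set [D i]: the points
    with bit true and those with bit false form disjoint analytic sets. Elsewhere these bits may
    code no point, or a point outside the section, so both are tested, with [x] as default. *)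
Lemma measurable_section_fun (C : set (X * X)) : measurable C ->
  (forall x y y', C (x, y) -> C (x, y') -> y = y') ->
  exists f : X -> X, [/\ measurable_fun setT f,
    forall x, C (x, f x) \/ f x = x & forall x y, C (x, y) -> f x = y].
Proof.
move=> mC Cu.
have bcp := prod_borel_code bc bc.
pose A i b := [set x | exists y, C (x, y) /\ phi y i = b].
have aA i b : analytic phi (A i b).
  apply: (analytic_proj (psiX := psi) (A := C `&` [set p | phi p.2 i = b]) bc).
  apply: (measurable_analytic bcp); apply: measurableI => //.
  rewrite (_ : [set _ | _] = setT `*` cylinder phi [:: (i, b)]).
    by apply: measurableX => //; exact: measurable_cylinder.
  apply/seteqP; split=> -[x y] /=; rewrite /cylinder /= andbT; first by move=> ->; split.
  by move=> [_ /eqP].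
have /choice [D hD] : forall i, exists D, [/\ measurable D, A i true `<=` D & A i false `<=` ~` D].
  move=> i; have [|D mD [h1 h2]] := lusin_separation bc (aA i true) (aA i false).
    rewrite -subset0 => x [[y [xy hy]] [y' [xy' hy']]].
    by move: hy; rewrite (Cu _ _ _ xy xy') hy'.
  by exists D.
pose al x i := `[< D i x >].
have mal i : measurable [set x | al x i].
  rewrite (_ : [set _ | _] = D i); first by case: (hD i).
  by apply/seteqP; split=> x /asboolP.
have alE x y : C (x, y) -> phi y = al x.
  move=> xy; apply/funext => i; have [_ h1 h2] := hD i.
  have [e|e] := boolP (phi y i); apply/esym.
    by apply/asboolP; apply: h1; exists y.
  by apply/asboolP; apply: h2; exists y; split=> //; exact/negbTE.
pose g x := if pselect (exists y, phi y = al x) is left h then projT1 (cid h) else x.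
have gP x : (exists y, phi y = al x) -> phi (g x) = al x.
  by rewrite /g; case: pselect => // h _; case: (cid h).
have gN x : ~ (exists y, phi y = al x) -> g x = x.
  by rewrite /g; case: pselect.
have mIm : measurable [set x | exists y, phi y = al x].
  rewrite (_ : [set _ | _] = \bigcap_k \bigcup_l [set x | psi k l (al x)]).
    apply: bigcap_measurable => // k _; apply: bigcup_measurable => l _.
    by have [m hm] := bc_fin bc k l; exact: measurable_finitary hm.
  apply/seteqP; split=> x.
    by move=> /(bc_im bc) h k _; have [l hl] := h k; exists l.
  move=> h; apply/(bc_im bc) => k; have [l _ hl] := h k I; by exists l.
have mg : measurable_fun setT g.
  apply: measurable_fun_code => i.
  rewrite (_ : [set _ | _] = ([set x | exists y, phi y = al x] `&` [set x | al x i]) `|`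
     (~` [set x | exists y, phi y = al x] `&` [set x | phi x i])).
    apply: measurableU; apply: measurableI => //; first exact: measurableC.
    exact: bc_meas bc i.
  apply/seteqP; split=> x /=.
    have [h|h] := pselect (exists y, phi y = al x).
      by rewrite gP // => hi; left.
    by rewrite gN // => hi; right.
  by move=> [[h hi]|[h hi]]; [rewrite gP | rewrite gN].
have mCg : measurable [set x | C (x, g x)].
  have := measurable_fun_pair (@measurable_id _ X setT) mg.
  by move=> /(_ measurableT _ mC); rewrite setTI.
exists (fun x => if `[< C (x, g x) >] then g x else x); split.
- apply: measurable_fun_code => i.
  rewrite (_ : [set _ | _] = ([set x | C (x, g x)] `&` [set x | phi (g x) i]) `|`
     (~` [set x | C (x, g x)] `&` [set x | phi x i])).
    apply: measurableU; apply: measurableI => //; last exact: bc_meas bc i.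
      by have := mg measurableT _ (bc_meas bc i); rewrite setTI.
    exact: measurableC.
  apply/seteqP; split=> x /=.
    by case: ifP => [/asboolP h hi|/negbT/asboolPn h hi]; [left | right].
  by move=> [[h hi]|[h hi]]; case: ifP => [/asboolP|/negbT/asboolPn].
- by move=> x; case: ifP => [/asboolP|_]; [left | right].
- move=> x y xy; have e : g x = y.
    by apply: (bc_inj bc); rewrite (alE _ _ xy) gP //; exists y; exact: alE.
  by rewrite e asboolT.
Qed.

(* Lusin-Novikov for finite sections: each point of [G] is isolated in its
   section by a cylinder, so the coanalytic sets of points isolated by a given
   cylinder cover [G]; Novikov separation shrinks them to Borel ones. *)
Lemma lusin_novikov (G : set (X * X)) : measurable G ->
  (forall x, finite_set [set y | G (x, y)]) ->
  exists f : nat -> X -> X, [/\ forall n, measurable_fun setT (f n),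
    forall n x, G (x, f n x) \/ f n x = x & forall x y, G (x, y) -> exists n, f n x = y].
Proof.
move=> mG fG.
have bcp := prod_borel_code bc bc.
pose sq (n : nat) : seq (nat * bool) := odflt [::] (unpickle n).
pose K n := cylinder phi (sq n).
have mK n : measurable (K n) by exact: measurable_cylinder.
(* The points that [K n] fails to isolate in their section: an existential condition, hence
   analytic. No point is in all of these sets, by [cylinder_isolates]. *)
pose Q n : set (X * X) := [set p | G p /\
  exists z, ~ K n p.2 \/ [/\ G (p.1, z), K n z & z <> p.2]].
have aQ n : analytic (prod_phi phi phi) (Q n).
  pose Q3 : set (X * X * X) := [set p | G p.1 /\
    (~ K n p.1.2 \/ [/\ G (p.1.1, p.2), K n p.2 & p.2 <> p.1.2])].
  apply: (analytic_ext (A := [set p | exists z, Q3 (p, z)])).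
    by move=> p; split=> [[z [h1 h2]]|[h1 [z h2]]]; [split=> //; exists z | exists z; split].
  apply: (analytic_proj (psiX := psi) bc); apply: (measurable_analytic (prod_borel_code bcp bc)).
  have m1 : measurable_fun setT (fun p : X * X * X => p.1) := measurable_fst.
  have m2 : measurable_fun setT (fun p : X * X * X => p.2) := measurable_snd.
  have m11 : measurable_fun setT (fun p : X * X * X => p.1.1) := measurableT_comp measurable_fst m1.
  have m12 : measurable_fun setT (fun p : X * X * X => p.1.2) := measurableT_comp measurable_snd m1.
  have m112 := measurable_fun_pair m11 m2.
  have e1 := m1 measurableT _ mG; have e2 := m112 measurableT _ mG.
  have e3 := m2 measurableT _ (mK n); have e4 := m12 measurableT _ (mK n).
  have e5 := measurable_diag m2 m12.
  rewrite !setTI in e1 e2 e3 e4.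
  rewrite (_ : Q3 = (fun p => p.1) @^-1` G `&` (~` ((fun p => p.1.2) @^-1` K n) `|`
    (((fun p => (p.1.1, p.2)) @^-1` G `&` (fun p => p.2) @^-1` K n) `&`
      ~` [set p | p.2 = p.1.2]))).
    apply: measurableI => //; apply: measurableU; first exact: measurableC.
    by apply: measurableI; [exact: measurableI | exact: measurableC].
  apply/seteqP; split=> p /=.
    by move=> [h1 [h2|[h2 h3 h4]]]; split=> //; [left | right].
  by move=> [h1 [h2|[[h2 h3] h4]]]; split=> //; [left | right].
have Q0 : \bigcap_n Q n = set0.
  rewrite -subset0 => -[x y] h.
  have [s [ys hs]] := cylinder_isolates y (fG x).
  have [_ [z]] := h (pickle s) I; rewrite /= /K /sq pickleK /=.
  by move=> [//|[h1 h2]]; apply; exact: hs.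
have [B [mB QB B0]] := novikov_separation bcp aQ Q0.
have /choice [f hf] : forall n, exists f : X -> X, [/\ measurable_fun setT f,
    forall x, (G `\` B n) (x, f x) \/ f x = x & forall x y, (G `\` B n) (x, y) -> f x = y].
  move=> n; apply: measurable_section_fun; first exact: measurableD.
  move=> x y y' [h1 h2] [h3 h4]; apply: contrapT => yy'.
  have [h5|h5] := pselect (K n y'); last first.
    by apply: h4; apply: QB; split=> //; exists y; left.
  apply: h2; apply: QB; split=> //; exists y'; right; split=> //; exact: nesym.
exists f; split.
- by move=> n; case: (hf n).
- by move=> n x; case: (hf n) => _ /(_ x) [[]|]; auto.
- move=> x y xy; apply: contrapT => no.
  have : (\bigcap_n B n) (x, y).
    move=> n _; apply: contrapT => nB; apply: no; exists n.
    by case: (hf n) => _ _; apply.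
  by rewrite B0.
Qed.

End Uniformization.
(** * Borel complexity *)

Section MeasurablePredicates.
Context d (X : measurableType d).
Implicit Types (P Q : X -> Prop).

Definition measurable_pred P : Prop := measurable [set x | P x].

Lemma mes_ext P Q : (forall x, P x <-> Q x) -> measurable_pred Q -> measurable_pred P.
Proof.
by move=> PQ; rewrite /measurable_pred (_ : [set x | P x] = [set x | Q x]) //;
  apply/seteqP; split=> x /PQ.
Qed.

Lemma mes_const (P : Prop) : measurable_pred (fun=> P).
Proof.
have [h|h] := pselect P.
  by rewrite /measurable_pred (_ : [set _ | _] = setT) //; apply/seteqP; split.
by rewrite /measurable_pred (_ : [set _ | _] = set0) //; apply/seteqP; split.
Qed.

Lemma mes_not P : measurable_pred P -> measurable_pred (fun x => ~ P x).
Proof. exact: measurableC. Qed.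

Lemma mes_and P Q : measurable_pred P -> measurable_pred Q -> measurable_pred (fun x => P x /\ Q x).
Proof. exact: measurableI. Qed.

Lemma mes_or P Q : measurable_pred P -> measurable_pred Q -> measurable_pred (fun x => P x \/ Q x).
Proof. exact: measurableU. Qed.

Lemma mes_imp P Q : measurable_pred P -> measurable_pred Q -> measurable_pred (fun x => P x -> Q x).
Proof.
move=> mP mQ; apply: (@mes_ext _ (fun x => ~ P x \/ Q x)).
  by move=> x; have [h|h] := pselect (P x); tauto.
by apply: mes_or => //; exact: mes_not.
Qed.

Lemma mes_iff P Q : measurable_pred P -> measurable_pred Q -> measurable_pred (fun x => P x <-> Q x).
Proof. by move=> mP mQ; apply: mes_and; exact: mes_imp. Qed.

Lemma mes_ex (I : countType) (P : I -> X -> Prop) : (forall i, measurable_pred (P i)) ->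
  measurable_pred (fun x => exists i, P i x).
Proof.
move=> mP; rewrite /measurable_pred (_ : [set _ | _] =
  \bigcup_n (if unpickle n is Some i then [set x | P i x] else set0)).
  by apply: bigcup_measurable => n _; case: (unpickle n) => [i|//]; exact: mP.
apply/seteqP; split=> x /=.
  by move=> [i hi]; exists (pickle i) => //; rewrite pickleK.
by move=> [n _]; case: (unpickle n) => // i hi; exists i.
Qed.

Lemma mes_all (I : countType) (P : I -> X -> Prop) : (forall i, measurable_pred (P i)) ->
  measurable_pred (fun x => forall i, P i x).
Proof.
move=> mP; apply: (@mes_ext _ (fun x => ~ exists i, ~ P i x)).
  move=> x; split=> [h [i]|h i]; first by apply.
  by apply: contrapT => h'; apply: h; exists i.
by apply/mes_not/mes_ex => i; exact: mes_not.
Qed.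

(** The objects vary with [x], but their codes form a fixed countable type. As neighbours of coded
    objects are coded, the intermediate vertex of a path ranges over codes. *)
Lemma mes_dle (O : Type) (I : countType) (D : X -> I -> O) (S : X -> O -> O -> Prop) :
  (forall c c', measurable_pred (fun x => D x c = D x c')) ->
  (forall c c', measurable_pred (fun x => S x (D x c) (D x c'))) ->
  (forall x a c, S x a (D x c) -> exists c', a = D x c') ->
  forall n c c', measurable_pred (fun x => dle (S x) n (D x c) (D x c')).
Proof.
move=> meq mS cov; elim=> [|n IH] c c' /=; first exact: meq.
apply: mes_or => //.
apply: (@mes_ext _ (fun x => exists b, dle (S x) n (D x c) (D x b) /\ S x (D x b) (D x c'))).
  move=> x; split=> [[z h1 h2]|[b [h1 h2]]]; last by exists (D x b).
  by have [b e] := cov x z c' h2; exists b; rewrite -e.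
by apply: mes_ex => b; apply: mes_and.
Qed.

End MeasurablePredicates.

Definition conn_class {A : Type} (S : A -> A -> Prop) (x : A) : set A :=
  [set y | conn S x y].

Lemma conn_class_eq (A : Type) (S : A -> A -> Prop) x y : symm S ->
  conn S x y -> conn_class S x = conn_class S y.
Proof.
move=> sS xy; apply/seteqP; split=> z; last exact: conn_trans.
by apply: conn_trans; exact: conn_sym.
Qed.

(** * Colouring of the half-spaces by labels made of cylinders *)

Section ColorDefs.
Context {X : choiceType} (phi : X -> nat -> bool) (G : X -> X -> Prop) (C : set X).
Implicit Types (H K L : set X).

(* A label lists cylinders isolating the boundary points of [H] together with
   their side: this separates [H] from finitely many other half-spaces. *)
Definition cut_label (l : seq (seq (nat * bool) * bool)) H : Prop :=
  (forall p, p \in l -> exists a, [/\ boundary G H a, cylinder phi p.1 a & (H a <-> p.2)]) /\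
  (forall a, boundary G H a -> exists p, [/\ p \in l, cylinder phi p.1 a & (H a <-> p.2)]).

(** The pairs that [color_inj] has to tell apart; each half-space is in finitely many of them. *)
Definition conflict H K : Prop :=
  K <> H /\ exists L, [/\ half_space G C L, near C L H & near C L K].

Definition label_of_nat (k : nat) : seq (seq (nat * bool) * bool) :=
  odflt [::] (unpickle k).

Definition good_color H k : Prop := cut_label (label_of_nat k) H /\
  forall K, half_space G C K -> conflict H K -> ~ cut_label (label_of_nat k) K.

Definition least_color H k : Prop :=
  good_color H k /\ forall j, j < k -> ~ good_color H j.

(* Junk value [0] if no label is good, which does not happen on half-spaces. *)
Definition color H : nat :=
  if pselect (exists k, least_color H k) is left h then projT1 (cid h) else 0.

Lemma least_color_uniq H j k : least_color H j -> least_color H k -> j = k.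
Proof.
move=> [g1 h1] [g2 h2]; have [lt|lt|//] := ltngtP j k.
  by case: (h2 j lt).
by case: (h1 k lt).
Qed.

(** Replaces the choice made in [color] by an explicit condition, whose quantifiers can be read over
    countable codes. *)
Lemma colorP H k : color H = k <->
  least_color H k \/ (~ (exists k, least_color H k) /\ k = 0).
Proof.
rewrite /color; case: pselect => [h|h]; last first.
  by split=> [<-|[h'|[_ ->]//]]; [right | case: h; exists k].
case: (cid h) => j hj /=; split=> [<-|[hk|[]//]]; first by left.
exact: least_color_uniq hj hk.
Qed.

End ColorDefs.

Section Color.
Context d (X : measurableType d) (phi : X -> nat -> bool)
  (psi : nat -> nat -> (nat -> bool) -> Prop) (bc : borel_code phi psi).
Context (G : X -> X -> Prop) (C : set X) (r : nat).
Hypotheses (Gsym : symm G) (Gfin : forall x, finite_set [set y | G x y]).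
Hypotheses (Ccl : forall u v, C u -> G u v -> C v).
Hypotheses (Cconn : forall u v, C u -> C v -> conn G u v).
Hypothesis Cbot : bottleneck G C r.
Implicit Types (H K L : set X).

Lemma cross_sym H K : half_space G C H -> half_space G C K -> cross C H K -> cross C K H.
Proof.
move=> hH hK [c1 c2 c3 c4].
have eH := setDK (half_space_sub Ccl hH); have eK := setDK (half_space_sub Ccl hK).
have flip_sub A B : A `<=` C -> B `<=` C `\` A -> A `<=` C `\` B.
  by move=> hA hB x Ax; split; [exact: hA | move=> /hB[]].
split=> h.
- by apply: c4; exact: setDS.
- by apply: c2; apply: flip_sub h; exact: half_space_sub hH.
- apply: c3 => x [Cx Hx]; apply: contrapT => Kx; apply: Hx; apply: h.
  by split.
- by apply: c1; rewrite -eH -eK; exact: setDS.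
Qed.

Lemma near_sym H K : half_space G C H -> half_space G C K -> near C H K -> near C K H.
Proof.
move=> hH hK [->|->|h]; [exact: Or31 | apply: Or32 | apply: Or33].
  by rewrite setDK //; exact: half_space_sub hH.
exact: cross_sym.
Qed.

Lemma finite_conflict H : half_space G C H -> finite_set [set K | half_space G C K /\ conflict G C H K].
Proof.
move=> hH; have fin L : half_space G C L -> finite_set [set K | half_space G C K /\ near C L K].
  exact: (finite_near Gsym Gfin Ccl Cconn Cbot).
apply: (@sub_finite_set _ _ (\bigcup_(L in [set L | half_space G C L /\ near C H L])
   [set K | half_space G C K /\ near C L K])).
  move=> K [hK [_ [L [hL LH LK]]]]; exists L => //=; split=> //.
  exact: near_sym.
by apply: bigcup_finite; [exact: fin | move=> L [hL _]; exact: fin].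
Qed.

(** For each boundary point of [H] take a cylinder isolating it among the boundary points of [H] and
    of the finitely many conflicting half-spaces. A conflicting [K] with the resulting label has the
    boundary and the sides of [H], hence equals [H] by [bd_determines]. *)
Lemma good_color_exists H : half_space G C H -> exists k, good_color phi G C H k.
Proof.
move=> hH.
pose F := [set K | half_space G C K /\ conflict G C H K].
pose P := boundary G H `|` \bigcup_(K in F) boundary G K.
have fbd K : half_space G C K -> finite_set (boundary G K).
  exact: (finite_bd Gsym Gfin Ccl Cconn Cbot).
have fP : finite_set P.
  rewrite finite_setU; split; first exact: fbd.
  by apply: bigcup_finite; [exact: finite_conflict | move=> K [hK _]; exact: fbd].
have /choice [s hs_] : forall a, exists s, cylinder phi s a /\
    forall z, P z -> cylinder phi s z -> z = a.
  by move=> a; exact: (cylinder_isolates bc).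
have [t ht] := (finite_seqP _).1 (fbd H hH).
have tP a : a \in t <-> boundary G H a by rewrite ht.
pose l := [seq (s a, `[< H a >]) | a <- t].
exists (pickle l); rewrite /good_color /label_of_nat pickleK /=; split.
  split=> [p /mapP [a /tP ha ->]|a ha] /=.
    by exists a; split=> //; [case: (hs_ a) | split=> /asboolP].
  exists (s a, `[< H a >]); split; first by apply: map_f; exact/tP.
    by case: (hs_ a).
  by split=> /asboolP.
move=> K hK HK [l1 l2]; case: (HK) => neq _; apply: neq.
have sub2 a : boundary G K a -> boundary G H a /\ (H a <-> K a).
  move=> ha; have [p [/mapP [a' /tP ha' ->] /= ca e]] := l2 a ha.
  have aa' : a = a' by apply: (hs_ a').2 => //; right; exists K.
  subst a'; split=> //; split=> h; first by apply/e/asboolP.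
  by apply/asboolP/e.
have sub1 a : boundary G H a -> boundary G K a.
  move=> ha; have [|a' [ha' ca' _]] := l1 (s a, `[< H a >]).
    by apply: map_f; exact/tP.
  by rewrite -(_ : a' = a) //; apply: (hs_ a).2 => //; right; exists K.
apply: (bd_determines Gsym Ccl Cconn hK hH (B := boundary G H)) => //.
  by move=> a /sub2 [].
by move=> a /sub1 /sub2 [_]; tauto.
Qed.

Lemma good_color_color H : half_space G C H -> good_color phi G C H (color phi G C H).
Proof.
move=> hH; have [k hk] := nat_least (good_color_exists hH).
by have [[]|[]] := (colorP phi G C H _).1 erefl => // h _; case: h; exists k.
Qed.

Lemma color_inj L H K : half_space G C L -> half_space G C H -> half_space G C K ->
  near C L H -> near C L K -> color phi G C H = color phi G C K -> H = K.
Proof.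
move=> hL hH hK LH LK e; apply: contrapT => HK.
have [_ h1] := good_color_color hH; have [h2 _] := good_color_color hK.
apply: (h1 K hK); last by rewrite e.
by split; [exact: nesym | exists L].
Qed.

End Color.

(** * Borel coding of the objects attached to a class *)

Section Coding.
Context d (X : measurableType d) (phi : X -> nat -> bool)
  (psi : nat -> nat -> (nat -> bool) -> Prop) (bc : borel_code phi psi).
Context (G : X -> X -> Prop) (f : nat -> X -> X).
Hypotheses (Gsym : symm G) (Gfin : forall x, finite_set [set y | G x y]).
Hypotheses (Gmeas : measurable [set p | G p.1 p.2])
  (fmeas : forall n, measurable_fun setT (f n))
  (fconn : forall x y, conn G x y <-> exists n, f n x = y).
Hypothesis Gbot : forall x, exists r, bottleneck G (conn_class G x) r.
Implicit Types (x y z : X) (H K : set X) (U V : set (set X)).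

Local Notation C := (conn_class G).
Local Notation half x := (half_space G (C x)).
Local Notation col x := (color phi G (C x)).

Lemma class_closed x u v : C x u -> G u v -> C x v.
Proof. by move=> xu uv; exact: conn_trans xu (conn_edge uv). Qed.

Lemma class_conn x u v : C x u -> C x v -> conn G u v.
Proof. by move=> xu xv; apply: conn_trans xv; exact: conn_sym. Qed.

Lemma class_f x n : C x (f n x).
Proof. by apply/fconn; exists n. Qed.

Lemma class_refl x : C x x.
Proof. exact: conn_refl. Qed.

(* The objects attached to the class of [x] are coded by finite sequences of
   numbers relative to [x], via the enumeration [f ^~ x] of the class. *)
Definition cut_of x (c : nat * nat * nat * bool) : set X :=
  let: (i, j, n, b) := c in
  if b then C x `\` bcut G n (f i x) (f j x) else bcut G n (f i x) (f j x).

Definition star_code (c : nat * nat * nat * bool) := (c.1, ~~ c.2).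

Lemma cut_of_sub x c : cut_of x c `<=` C x.
Proof.
case: c => [[[i j] n] []] /=; first by move=> y [].
exact: (bcut_sub (@class_closed x) (class_f x i) (class_f x j)).
Qed.

Lemma cut_of_star x c : cut_of x (star_code c) = C x `\` cut_of x c.
Proof.
have h := @cut_of_sub x; case: c => [[[i j] n] []] //=.
by rewrite setDK //; exact: (h (i, j, n, false)).
Qed.

Lemma half_code x H : half x H -> exists c, H = cut_of x c.
Proof.
move=> [[a [b [n [/fconn [i <-] /fconn [j <-] [->|->]]]]] _ _].
  by exists (i, j, n, false).
by exists (i, j, n, true).
Qed.

Lemma half_cut_of x c : half x (cut_of x c) <->
  (exists k, cut_of x c (f k x)) /\ (exists k, cut_of x (star_code c) (f k x)).
Proof.
have mem H : H `<=` C x -> (H !=set0 <-> exists k, H (f k x)).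
  move=> HC; split=> [[y Hy]|[k hk]]; last by exists (f k x).
  by have /fconn [k e] := HC y Hy; exists k; rewrite e.
rewrite -(mem (cut_of x c)) -?(mem (cut_of x (star_code c))) ?cut_of_star;
  try by [exact: cut_of_sub | move=> y []].
split=> [[]//|[h1 h2]]; split=> //.
case: c {h1 h2} => [[[i j] n] b]; exists (f i x), (f j x), n.
by split; [exact: class_f | exact: class_f | case: b; [right | left]].
Qed.

Let mes_f2 (S : set (X * X)) i j : measurable S -> measurable_pred (fun x => S (f i x, f j x)).
Proof.
move=> mS; have := measurable_fun_pair (fmeas i) (fmeas j) measurableT mS.
by rewrite setTI.
Qed.

Lemma mes_edge i j : measurable_pred (fun x => G (f i x) (f j x)).
Proof. exact: (mes_f2 i j Gmeas). Qed.

Lemma mes_eq i j : measurable_pred (fun x => f i x = f j x).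
Proof. exact: (measurable_diag bc). Qed.

Lemma edge_code x y n : G y (f n x) -> exists k, y = f k x.
Proof.
move=> /Gsym h; have /fconn [k <-] := class_closed (class_f x n) h.
by exists k.
Qed.

Lemma mes_dist n i j : measurable_pred (fun x => dle G n (f i x) (f j x)).
Proof.
apply: (@mes_dle _ _ _ _ (fun x n => f n x) (fun _ => G)).
- exact: mes_eq.
- exact: mes_edge.
- by move=> x y k; exact: edge_code.
Qed.

Lemma mes_bcut n i j k : measurable_pred (fun x => bcut G n (f i x) (f j x) (f k x)).
Proof.
case: n => [|n] /=; first exact: mes_eq.
apply: mes_and; first by apply: mes_not; exact: mes_dist.
apply: mes_ex => m.
apply: (@mes_dle _ _ _ _ (fun x n => f n x)
  (fun x => restr G (fun c => ~ dle G n (f i x) c))).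
- exact: mes_eq.
- move=> a b; apply: (@mes_ext _ _ _ (fun x => G (f a x) (f b x) /\
    (~ dle G n (f i x) (f a x) /\ ~ dle G n (f i x) (f b x)))).
    by move=> x; split=> [[h1 h2 h3]|[h1 [h2 h3]]].
  apply: mes_and; first exact: mes_edge.
  by apply: mes_and; apply: mes_not; exact: mes_dist.
- by move=> x a c [h _ _]; exact: edge_code h.
Qed.

Lemma mes_cut c k : measurable_pred (fun x => cut_of x c (f k x)).
Proof.
case: c => [[[i j] n] []] /=; last exact: mes_bcut.
apply: (@mes_ext _ _ _ (fun x => ~ bcut G n (f i x) (f j x) (f k x))).
  by move=> x; split=> [[]//|h]; split=> //; exact: class_f.
by apply: mes_not; exact: mes_bcut.
Qed.

Lemma mes_sub c c' : measurable_pred (fun x => cut_of x c `<=` cut_of x c').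
Proof.
apply: (@mes_ext _ _ _ (fun x => forall k, cut_of x c (f k x) -> cut_of x c' (f k x))).
  move=> x; split=> [h k|h y hy]; first exact: h.
  by have /fconn [k e] := cut_of_sub hy; move: hy; rewrite -e; exact: h.
by apply: mes_all => k; apply: mes_imp; exact: mes_cut.
Qed.

Lemma mes_cut_eq c c' : measurable_pred (fun x => cut_of x c = cut_of x c').
Proof.
apply: (@mes_ext _ _ _ (fun x => cut_of x c `<=` cut_of x c' /\ cut_of x c' `<=` cut_of x c)).
  by move=> x; split=> [->|[h1 h2]]; [split | exact/seteqP].
by apply: mes_and; exact: mes_sub.
Qed.

Lemma mes_half c : measurable_pred (fun x => half x (cut_of x c)).
Proof.
apply: (mes_ext (fun x => half_cut_of x c)).
by apply: mes_and; apply: mes_ex => k; exact: mes_cut.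
Qed.

Lemma mes_near c c' : measurable_pred (fun x => near (C x) (cut_of x c) (cut_of x c')).
Proof.
apply: (@mes_ext _ _ _ (fun x => cut_of x c' = cut_of x c \/ (cut_of x c' = cut_of x (star_code c) \/
  ((~ cut_of x c `<=` cut_of x c' /\ ~ cut_of x c `<=` cut_of x (star_code c')) /\
   (~ cut_of x (star_code c) `<=` cut_of x c' /\
    ~ cut_of x (star_code c) `<=` cut_of x (star_code c')))))).
  move=> x; rewrite /near /cross !cut_of_star.
  split=> [[h|h|[h1 h2 h3 h4]]|[h|[h|[[h1 h2] [h3 h4]]]]]; [tauto | tauto | tauto|..].
  - exact: Or31.
  - exact: Or32.
  - by apply: Or33.
apply: mes_or; first exact: mes_cut_eq.
apply: mes_or; first exact: mes_cut_eq.
by apply: mes_and; apply: mes_and; apply: mes_not; exact: mes_sub.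
Qed.

Lemma mes_bd c k : measurable_pred (fun x => boundary G (cut_of x c) (f k x)).
Proof.
apply: (@mes_ext _ _ _ (fun x => exists l, G (f k x) (f l x) /\
  (cut_of x c (f k x) <-> ~ cut_of x c (f l x)))).
  move=> x; split=> [[b kb h]|[l [h1 h2]]]; last by exists (f l x).
  have /fconn [l e] := class_closed (class_f x k) kb.
  by exists l; rewrite e.
apply: mes_ex => l; apply: mes_and; first exact: mes_edge.
apply: mes_iff; first exact: mes_cut.
by apply: mes_not; exact: mes_cut.
Qed.

Lemma bd_code x c a : boundary G (cut_of x c) a -> exists k, a = f k x.
Proof.
move=> h; have /fconn [k <-] := bd_sub Gsym (@class_closed x) (@cut_of_sub x c) h.
by exists k.
Qed.

Lemma mes_cylinder s k : measurable_pred (fun x => cylinder phi s (f k x)).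
Proof.
have := fmeas k measurableT (measurable_cylinder bc s).
by rewrite setTI.
Qed.

Lemma mes_cut_label l c : measurable_pred (fun x => cut_label phi G l (cut_of x c)).
Proof.
have mP (p : seq (nat * bool) * bool) k : measurable_pred (fun x => boundary G (cut_of x c) (f k x) /\
    (cylinder phi p.1 (f k x) /\ (cut_of x c (f k x) <-> p.2))).
  apply: mes_and; first exact: mes_bd.
  apply: mes_and; first exact: mes_cylinder.
  by apply: mes_iff; [exact: mes_cut | exact: mes_const].
apply: mes_and.
  apply: mes_all => p; apply: mes_imp; first exact: mes_const.
  apply: (@mes_ext _ _ _ _ _ (mes_ex (fun k => mP p k))) => x.
  split=> [[a [h1 h2 h3]]|[k [h1 [h2 h3]]]]; last by exists (f k x).
  by have [k e] := bd_code h1; exists k; rewrite -e.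
apply: (@mes_ext _ _ _ (fun x => forall k, boundary G (cut_of x c) (f k x) ->
  exists p, p \in l /\ (boundary G (cut_of x c) (f k x) /\
    (cylinder phi p.1 (f k x) /\ (cut_of x c (f k x) <-> p.2))))).
  move=> x; split=> [h k hk|h a ha].
    by have [p [h1 h2 h3]] := h _ hk; exists p.
  have [k e] := bd_code ha; subst a.
  by have [p [h1 [_ [h2 h3]]]] := h k ha; exists p.
apply: mes_all => k; apply: mes_imp; first exact: mes_bd.
by apply: mes_ex => p; apply: mes_and; [exact: mes_const | exact: mP].
Qed.

Lemma mes_conflict c c' : measurable_pred (fun x => conflict G (C x) (cut_of x c) (cut_of x c')).
Proof.
apply: mes_and; first by apply: mes_not; exact: mes_cut_eq.
apply: (@mes_ext _ _ _ (fun x => exists e, half x (cut_of x e) /\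
  (near (C x) (cut_of x e) (cut_of x c) /\ near (C x) (cut_of x e) (cut_of x c')))).
  move=> x; split=> [[L [hL h1 h2]]|[e [h1 [h2 h3]]]]; last by exists (cut_of x e).
  by have [e eL] := half_code hL; exists e; rewrite -eL.
apply: mes_ex => e; apply: mes_and; first exact: mes_half.
by apply: mes_and; exact: mes_near.
Qed.

Lemma mes_good_color c k : measurable_pred (fun x => good_color phi G (C x) (cut_of x c) k).
Proof.
apply: mes_and; first exact: mes_cut_label.
apply: (@mes_ext _ _ _ (fun x => forall c', half x (cut_of x c') ->
  conflict G (C x) (cut_of x c) (cut_of x c') ->
  ~ cut_label phi G (label_of_nat k) (cut_of x c'))).
  move=> x; split=> [h c'|h K hK]; first exact: h.
  by have [c' e] := half_code hK; move: hK; rewrite e; exact: h.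
apply: mes_all => c'; apply: mes_imp; first exact: mes_half.
apply: mes_imp; first exact: mes_conflict.
by apply: mes_not; exact: mes_cut_label.
Qed.

Lemma mes_color c k : measurable_pred (fun x => col x (cut_of x c) = k).
Proof.
have ml j : measurable_pred (fun x => least_color phi G (C x) (cut_of x c) j).
  apply: mes_and; first exact: mes_good_color.
  apply: mes_all => i; apply: mes_imp; first exact: mes_const.
  by apply: mes_not; exact: mes_good_color.
apply: (mes_ext (fun x => colorP phi G (C x) (cut_of x c) k)).
apply: mes_or; first exact: ml.
apply: mes_and; last exact: mes_const.
by apply: mes_not; apply: mes_ex.
Qed.

Lemma mes_nat_fun2 (F F' : X -> nat) (P : nat -> nat -> Prop) :
  (forall k, measurable_pred (fun x => F x = k)) -> (forall k, measurable_pred (fun x => F' x = k)) ->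
  measurable_pred (fun x => P (F x) (F' x)).
Proof.
move=> mF mF'; apply: (@mes_ext _ _ _ (fun x => exists k : nat, exists l : nat,
  (F x = k /\ F' x = l) /\ P k l)).
  by move=> x; split=> [h|[k [l [[-> ->]]]]] //; exists (F x), (F' x).
apply: mes_ex => k; apply: mes_ex => l; apply: mes_and; last exact: mes_const.
by apply: mes_and.
Qed.

Lemma mes_wall_color c n : measurable_pred (fun x => wall_color (C x) (col x) (cut_of x c) = n).
Proof.
apply: (@mes_nat_fun2 (fun x => col x (cut_of x c)) (fun x => col x (C x `\` cut_of x c))
  (fun a b => minn a b = n)); first exact: mes_color.
move=> k; apply: (@mes_ext _ _ _ _ _ (mes_color (star_code c) k)) => x.
by rewrite cut_of_star.
Qed.

(** Every orientation is a principal one changed on finitely many half-spaces, so a point and a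
    finite list of cuts code it. A code need not give an orientation; [orientation_ofP] tests
    whether it does. *)
Definition orientation_of x (u : nat * seq (nat * nat * nat * bool)) : set (set X) :=
  [set H | half x H /\
    ((H (f u.1 x) /\ ~ (exists c, c \in u.2 /\ H = cut_of x c)) \/
     (~ H (f u.1 x) /\ exists c, c \in u.2 /\ H = cut_of x c))].

Lemma orientation_of_half x u : orientation_of x u `<=` half x.
Proof. by move=> H []. Qed.

Lemma mes_orientation_of u c : measurable_pred (fun x => orientation_of x u (cut_of x c)).
Proof.
have mE : measurable_pred (fun x => exists c', c' \in u.2 /\ cut_of x c = cut_of x c').
  by apply: mes_ex => c'; apply: mes_and; [exact: mes_const | exact: mes_cut_eq].
apply: mes_and; first exact: mes_half.
apply: mes_or; apply: mes_and => //; try exact: mes_cut.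
  by apply: mes_not.
by apply: mes_not; exact: mes_cut.
Qed.

Local Notation ori x := (orientation (C x) (half x)).

Let half_star x H : half x H -> half x (C x `\` H).
Proof. exact: (half_space_star (@class_closed x)). Qed.

Lemma class_separating x y z : C x y -> C x z ->
  finite_set [set H | half x H /\ H y /\ ~ H z].
Proof.
have [r hr] := Gbot x.
exact: (finite_separating Gsym Gfin (@class_closed x) (@class_conn x) hr).
Qed.

Lemma orientation_ofP x u : ori x (orientation_of x u) <->
  (forall c, half x (cut_of x c) -> (orientation_of x u (cut_of x c) <->
     ~ orientation_of x u (cut_of x (star_code c)))) /\
  (forall c c', orientation_of x u (cut_of x c) -> half x (cut_of x c') ->
     cut_of x c `<=` cut_of x c' -> orientation_of x u (cut_of x c')).
Proof.
split=> [[_ h1 h2 _]|[h1 h2]].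
  by split=> [c hc|c c']; [rewrite cut_of_star; exact: h1 | exact: h2].
split.
- exact: orientation_of_half.
- move=> H hH; have [c e] := half_code hH; subst H.
  by rewrite -cut_of_star; exact: h1.
- move=> H K hH hK; have [c e] := half_code (orientation_of_half hH).
  by have [c' e'] := half_code hK; subst H K; exact: h2.
- move=> y Cy.
  apply: (@sub_finite_set _ _ ([set H | half x H /\ H (f u.1 x) /\ ~ H y] `|`
     (cut_of x @` [set` u.2]))).
    move=> H [[hH [[h3 h4]|[h3 [c [cu ->]]]]] Hy]; first by left.
    by right; exists c.
  rewrite finite_setU; split; first by apply: class_separating => //; exact: class_f.
  exact: finite_image.
Qed.

Lemma mes_orientation u : measurable_pred (fun x => ori x (orientation_of x u)).
Proof.
apply: (mes_ext (fun x => orientation_ofP x u)).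
apply: mes_and.
  apply: mes_all => c; apply: mes_imp; first exact: mes_half.
  apply: mes_iff; first exact: mes_orientation_of.
  by apply: mes_not; exact: mes_orientation_of.
apply: mes_all => c; apply: mes_all => c'.
apply: mes_imp; first exact: mes_orientation_of.
apply: mes_imp; first exact: mes_half.
by apply: mes_imp; [exact: mes_sub | exact: mes_orientation_of].
Qed.

(** The list codes the half-spaces on which [U] differs from the principal orientation at [x]. They
    are finitely many, since a half-space that contains [x] but is missing from [U] has its
    complement in [U]. *)
Lemma orientation_code x U : ori x U -> exists u, U = orientation_of x u.
Proof.
move=> vU; have [Us Uc Uu Uf] := vU.
have /fconn [i ix] := class_refl x.
pose D := [set H | half x H /\ ((U H /\ ~ H x) \/ (~ U H /\ H x))].
have sK H : half x H -> C x `\` (C x `\` H) = H.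
  by move=> hH; rewrite setDK //; exact: half_space_sub (@class_closed x) _ hH.
have fD : finite_set D.
  apply: (@sub_finite_set _ _ ([set H | U H /\ ~ H x] `|`
     (setD (C x) @` [set H | U H /\ ~ H x]))).
    move=> H [hH [//|[nU Hx]]]; [by left | right].
    exists (C x `\` H); last exact: sK.
    split; last by move=> [].
    by apply: contrapT => nU'; apply: nU; apply/Uc.
  by rewrite finite_setU; split; [|apply: finite_image]; apply: Uf; exact: class_refl.
have [t ht] := (finite_seqP _).1 fD.
have /choice [cd hcd] : forall H, exists c, half x H -> H = cut_of x c.
  move=> H; have [/half_code [c e]|n] := pselect (half x H); first by exists c.
  by exists (0, 0, 0, false).
have DE H : half x H -> (exists c, c \in [seq cd K | K <- t] /\ H = cut_of x c) <-> D H.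
  move=> hH; split.
    move=> [_ [/mapP [K Kt ->] ->]].
    have DK : D K by rewrite ht.
    by rewrite -hcd //; case: DK.
  move=> DH; exists (cd H); split; last exact: hcd.
  by apply: map_f; move: DH; rewrite ht.
exists (i, [seq cd K | K <- t]); apply/seteqP; split=> H.
  move=> UH; have hH := Us _ UH; split=> //=; rewrite DE // ix.
  have [Hx|Hx] := pselect (H x); [left | right]; split=> //.
    by move=> [_ [[]|[]]].
  by split=> //; left.
move=> [hH]; rewrite /= DE // ix => -[[Hx nD]|[Hx [_ [[]|[]]]]] //.
by apply: contrapT => UH; apply: nD; split=> //; right.
Qed.

Lemma mes_orientation_eq u v : measurable_pred (fun x => orientation_of x u = orientation_of x v).
Proof.
apply: (@mes_ext _ _ _ (fun x => forall c,
  orientation_of x u (cut_of x c) <-> orientation_of x v (cut_of x c))).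
  move=> x; split=> [-> //|h]; apply/seteqP; split=> H hH.
    by have [c e] := half_code (orientation_of_half hH); subst H; apply/h.
  by have [c e] := half_code (orientation_of_half hH); subst H; apply/h.
by apply: mes_all => c; apply: mes_iff; exact: mes_orientation_of.
Qed.

Lemma mes_minimal u c : measurable_pred (fun x => minimal (orientation_of x u) (cut_of x c)).
Proof.
apply: mes_and; first exact: mes_orientation_of.
apply: (@mes_ext _ _ _ (fun x => forall c', orientation_of x u (cut_of x c') ->
  cut_of x c' `<=` cut_of x c -> cut_of x c' = cut_of x c)).
  move=> x; split=> [h c'|h K hK]; first exact: h.
  by have [c' e] := half_code (orientation_of_half hK); move: hK; rewrite e; exact: h.
apply: mes_all => c'; apply: mes_imp; first exact: mes_orientation_of.
by apply: mes_imp; [exact: mes_sub | exact: mes_cut_eq].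
Qed.

Lemma mes_differ_below c u v : measurable_pred (fun x =>
  differ_below (C x) (col x) (wall_color (C x) (col x) (cut_of x c))
    (orientation_of x u) (orientation_of x v)).
Proof.
apply: (@mes_ext _ _ _ (fun x => forall c', orientation_of x u (cut_of x c') ->
  ~ orientation_of x v (cut_of x c') ->
  wall_color (C x) (col x) (cut_of x c') < wall_color (C x) (col x) (cut_of x c))).
  move=> x; split=> [h c'|h K hK]; first exact: h.
  by have [c' e] := half_code (orientation_of_half hK); move: hK; rewrite e; exact: h.
apply: mes_all => c'; apply: mes_imp; first exact: mes_orientation_of.
apply: mes_imp; first by apply: mes_not; exact: mes_orientation_of.
by apply: (@mes_nat_fun2 _ _ (fun a b => a < b)); exact: mes_wall_color.
Qed.

Lemma mes_label u c s : measurable_pred (fun x => label (C x) (col x) (orientation_of x u) (cut_of x c) s).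
Proof.
apply: mes_all => m; apply: mes_iff; first exact: mes_const.
apply: (@mes_ext _ _ _ (fun x => exists c', orientation_of x u (cut_of x c') /\
  (near (C x) (cut_of x c) (cut_of x c') /\ col x (cut_of x c') = m))).
  move=> x; split=> [[K [h1 h2 h3]]|[c' [h1 [h2 h3]]]]; last by exists (cut_of x c').
  by have [c' e] := half_code (orientation_of_half h1); exists c'; rewrite -e.
apply: mes_ex => c'; apply: mes_and; first exact: mes_orientation_of.
by apply: mes_and; [exact: mes_near | exact: mes_color].
Qed.

Lemma mes_selected u c : measurable_pred (fun x =>
  selected_flip (C x) (half x) (col x) (orientation_of x u) (cut_of x c)).
Proof.
apply: mes_ex => k; apply: mes_and; first exact: mes_label.
apply: (@mes_ext _ _ _ (fun x => forall v k', ori x (orientation_of x v) ->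
  minimal (orientation_of x v) (cut_of x c) ->
  differ_below (C x) (col x) (wall_color (C x) (col x) (cut_of x c))
    (orientation_of x u) (orientation_of x v) -> k' < k ->
  ~ label (C x) (col x) (orientation_of x v) (cut_of x c) (seq_of_nat k'))).
  move=> x; split=> [h v k'|h V k' hV]; first exact: h.
  by have [v e] := orientation_code hV; move: hV; rewrite e; exact: h.
apply: mes_all => v; apply: mes_all => k'.
apply: mes_imp; first exact: mes_orientation.
apply: mes_imp; first exact: mes_minimal.
apply: mes_imp; first exact: mes_differ_below.
apply: mes_imp; first exact: mes_const.
by apply: mes_not; exact: mes_label.
Qed.

Local Notation tedge x := (tree_edge (C x) (half x) (col x)).

Lemma mes_tree_flip c u v : measurable_pred (fun x =>
  tree_flip (C x) (half x) (col x) (cut_of x c) (orientation_of x u) (orientation_of x v)).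
Proof.
apply: (@mes_ext _ _ _ (fun x => (ori x (orientation_of x u) /\
  (minimal (orientation_of x u) (cut_of x c) /\
   (col x (cut_of x c) < col x (cut_of x (star_code c)) /\
   (selected_flip (C x) (half x) (col x) (orientation_of x u) (cut_of x c) /\
    forall c', half x (cut_of x c') -> (orientation_of x v (cut_of x c') <->
      ((orientation_of x u (cut_of x c') /\ ~ cut_of x c' = cut_of x c) \/
        cut_of x c' = cut_of x (star_code c))))))))).
  move=> x; rewrite cut_of_star; split=> [[h1 h2 h3 h4 h5]|[h1 [h2 [h3 [h4 h5]]]]].
    by do 4 split=> //; rewrite h5.
  split=> //; apply/seteqP; split=> H hH.
    have hh := orientation_of_half hH; have [c' e] := half_code hh; subst H.
    exact/(h5 _ hh).
  have hh : half x H.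
    case: hH => [[/orientation_of_half //]|->]; apply: half_star.
    exact: orientation_of_half h2.1.
  have [c' e] := half_code hh; subst H.
  exact/(h5 _ hh).
apply: mes_and; first exact: mes_orientation.
apply: mes_and; first exact: mes_minimal.
apply: mes_and; first by apply: (@mes_nat_fun2 _ _ (fun a b => a < b)); exact: mes_color.
apply: mes_and; first exact: mes_selected.
apply: mes_all => c'; apply: mes_imp; first exact: mes_half.
apply: mes_iff; first exact: mes_orientation_of.
apply: mes_or; last exact: mes_cut_eq.
apply: mes_and; first exact: mes_orientation_of.
by apply: mes_not; exact: mes_cut_eq.
Qed.

Lemma mes_tree_edge u v : measurable_pred (fun x => tedge x (orientation_of x u) (orientation_of x v)).
Proof.
apply: (@mes_ext _ _ _ (fun x => exists c,
  tree_flip (C x) (half x) (col x) (cut_of x c) (orientation_of x u) (orientation_of x v) \/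
  tree_flip (C x) (half x) (col x) (cut_of x c) (orientation_of x v) (orientation_of x u))).
  move=> x; split=> [[H hH]|[c hc]]; last by exists (cut_of x c).
  have [c e] : exists c, H = cut_of x c.
    by case: hH => -[[Us _ _ _] [UH _] _ _ _]; exact: half_code (Us _ UH).
  by exists c; rewrite -e.
by apply: mes_ex => c; apply: mes_or; exact: mes_tree_flip.
Qed.

Lemma principal_code x k : principal (half x) (f k x) = orientation_of x (k, [::]).
Proof.
apply/seteqP; split=> H; first by move=> [h1 h2]; split=> //; left; split=> // -[c []].
by move=> [h1 [[h2 _]|[_ [c []]]]].
Qed.

(** The Borel linear order that breaks ties between nearest points: the lexicographic order of the
    codes. *)
Definition lex_lt y z : Prop := exists2 n,
  (forall m, m < n -> phi y m = phi z m) & ~~ phi y n && phi z n.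

Lemma lex_irr y : ~ lex_lt y y.
Proof. by move=> [n _ /andP[/negP]]. Qed.

Lemma lex_trans x y z : lex_lt x y -> lex_lt y z -> lex_lt x z.
Proof.
move=> [n hn /andP[xn yn]] [m hm /andP[ym zm]].
have [lt|lt|e] := ltngtP n m.
- exists n; last by rewrite xn -hm.
  by move=> i il; rewrite hn // hm //; exact: ltn_trans lt.
- exists m; last by rewrite hn // ym.
  by move=> i il; rewrite hn ?hm //; exact: ltn_trans lt.
- by move: ym; rewrite -e yn.
Qed.

Lemma lex_total y z : y = z \/ lex_lt y z \/ lex_lt z y.
Proof.
have [e|ne] := pselect (forall n, phi y n = phi z n).
  by left; apply: (bc_inj bc); exact/funext.
have [|n [hn hmin]] := @nat_least (fun n => phi y n <> phi z n).
  by apply: contrapT => h; apply: ne => n; apply: contrapT => h'; apply: h; exists n.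
have {}hmin m : m < n -> phi y m = phi z m by move=> /hmin /contrapT.
right; case ey : (phi y n); case ez : (phi z n); rewrite ey ez // in hn.
  by right; exists n; [move=> m /hmin | rewrite ey ez].
by left; exists n => //; rewrite ey ez.
Qed.

Lemma mes_lex i j : measurable_pred (fun x => lex_lt (f i x) (f j x)).
Proof.
have mphi k n : measurable_pred (fun x => phi (f k x) n).
  by have := fmeas k measurableT (bc_meas bc n); rewrite setTI.
apply: (@mes_ext _ _ _ (fun x => exists n, (forall m, m < n ->
  (phi (f i x) m <-> phi (f j x) m)) /\ (~ phi (f i x) n /\ phi (f j x) n))).
  move=> x; split=> [[n h1 /andP[/negP h2 h3]]|[n [h1 [/negP h2 h3]]]]; exists n.
  - by split=> // m /h1 ->.
  - by move=> m /h1 e; apply/idP/idP => /e.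
  - by rewrite h2.
apply: mes_ex => n; apply: mes_and.
  by apply: mes_all => m; apply: mes_imp; [exact: mes_const | exact: mes_iff].
by apply: mes_and => //; exact: mes_not.
Qed.

Lemma tree_edge_orientation x U V : tedge x U V -> ori x U /\ ori x V.
Proof.
apply: tree_edge_vertex.
- exact: (half_space_sub (@class_closed x)).
- by move=> H [].
- exact: half_star.
Qed.

Lemma mes_tree_dist n u v : measurable_pred (fun x =>
  dle (tedge x) n (orientation_of x u) (orientation_of x v)).
Proof.
apply: (@mes_dle _ _ _ _ orientation_of (fun x => tedge x)).
- exact: mes_orientation_eq.
- exact: mes_tree_edge.
- by move=> x U v' /tree_edge_orientation [/orientation_code].
Qed.

Local Notation closest x := (nearest (C x) (principal (half x)) (tedge x) lex_lt).

Lemma mes_closest u k : measurable_pred (fun x => closest x (orientation_of x u) (f k x)).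
Proof.
apply: mes_and.
  by apply: (@mes_ext _ _ _ (fun=> True)); [move=> x; split=> // _; exact: class_f | exact: mes_const].
apply: mes_ex => n.
apply: (@mes_ext _ _ _ (fun x =>
  (dle (tedge x) n (orientation_of x u) (orientation_of x (k, [::])) /\
  ((forall l m, m < n -> ~ dle (tedge x) m (orientation_of x u) (orientation_of x (l, [::]))) /\
   (forall l, dle (tedge x) n (orientation_of x u) (orientation_of x (l, [::])) ->
      f l x = f k x \/ lex_lt (f k x) (f l x)))))).
  move=> x; split=> [[h1 h2 h3]|[h1 [h2 h3]]].
    rewrite -principal_code; split=> //; split=> l; rewrite -principal_code.
      by move=> m; apply: h2; exact: class_f.
    by apply: h3; exact: class_f.
  split; first by rewrite principal_code.
    by move=> z m /fconn [l <-]; rewrite principal_code; exact: h2.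
  by move=> z /fconn [l <-]; rewrite principal_code; exact: h3.
apply: mes_and; first exact: mes_tree_dist.
apply: mes_and.
  apply: mes_all => l; apply: mes_all => m; apply: mes_imp; first exact: mes_const.
  by apply: mes_not; exact: mes_tree_dist.
apply: mes_all => l; apply: mes_imp; first exact: mes_tree_dist.
by apply: mes_or; [exact: mes_eq | exact: mes_lex].
Qed.

Definition class_tree x : X -> X -> Prop :=
  contracted_edge (C x) (principal (half x)) (tedge x) lex_lt.

Lemma mes_class_tree i j : measurable_pred (fun x => class_tree x (f i x) (f j x)).
Proof.
apply: mes_and; first by apply: mes_not; exact: mes_eq.
apply: (@mes_ext _ _ _ (fun x => exists u, exists v,
  (tedge x (orientation_of x u) (orientation_of x v) /\
   (closest x (orientation_of x u) (f i x) /\ closest x (orientation_of x v) (f j x))))).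
  move=> x; split=> [[U [V [h1 h2 h3]]]|[u [v [h1 [h2 h3]]]]]; last first.
    by exists (orientation_of x u), (orientation_of x v).
  have [vU vV] := tree_edge_orientation h1.
  have [u eu] := orientation_code vU; have [v ev] := orientation_code vV.
  by exists u, v; rewrite -eu -ev.
apply: mes_ex => u; apply: mes_ex => v; apply: mes_and; first exact: mes_tree_edge.
by apply: mes_and; exact: mes_closest.
Qed.

(** The first point of a pair serves as base point of its class; by [class_tree_eq] the choice of
    base point does not matter. *)
Definition tree_graph : set (X * X) := [set p | class_tree p.1 p.1 p.2].

Lemma class_tree_mem x y z : class_tree x y z -> C x y /\ C x z.
Proof. exact: contracted_class. Qed.

Lemma class_tree_eq x y : C x y -> class_tree y = class_tree x.
Proof.
by move=> xy; rewrite /class_tree -(conn_class_eq Gsym xy).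
Qed.

Lemma measurable_tree_graph : measurable tree_graph.
Proof.
(* [mes_class_tree] speaks of enumerated points only, so [x] itself is written as some [f l x]. *)
pose A k := [set x | exists l, f l x = x /\ class_tree x (f l x) (f k x)].
rewrite (_ : tree_graph = \bigcup_k ([set p | f k p.1 = p.2] `&` fst @^-1` A k)).
  apply: bigcup_measurable => k _; apply: measurableI.
    exact: (measurable_diag bc (measurableT_comp (fmeas k) measurable_fst) measurable_snd).
  have mA : measurable (A k).
    apply: mes_ex => l; apply: mes_and; last exact: mes_class_tree.
    exact: (measurable_diag bc (fmeas l) (@measurable_id _ X setT)).
  by have := @measurable_fst _ _ X X measurableT _ mA; rewrite setTI.
apply/seteqP; split=> -[x y] /=.
  move=> h; have [_ /fconn [k e]] := class_tree_mem h.
  have /fconn [l el] := class_refl x.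
  by exists k => //; split=> //; exists l; rewrite el e.
by move=> [k _ [/= <- [l [e h]]]]; rewrite e in h.
Qed.

Lemma class_tree_spec x : [/\ symm (class_tree x),
  forall y z, C x y -> C x z -> conn (class_tree x) y z & bridges (class_tree x)].
Proof.
have [r hr] := Gbot x.
have C0 : C x !=set0 by exists x; exact: class_refl.
have HsC H : half x H -> H `<=` C x := @half_space_sub _ G (C x) (@class_closed x) H.
have HsN H : half x H -> H !=set0 by case.
have Hst := @half_star x.
have nf H : half x H -> finite_set [set K | half x K /\ near (C x) H K] :=
  finite_near Gsym Gfin (@class_closed x) (@class_conn x) hr (H := H).
have ci L H K : half x L -> half x H -> half x K -> near (C x) L H -> near (C x) L K ->
    col x H = col x K -> H = K :=
  color_inj bc Gsym Gfin (@class_closed x) (@class_conn x) hr (L := L) (H := H) (K := K).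
have sf y z : C x y -> C x z -> finite_set [set H | half x H /\ H y /\ ~ H z] :=
  @class_separating x y z.
have mf U : ori x U -> finite_set [set H | minimal U H].
  move=> vU; have [Us _ _ Uf] := vU.
  apply: (finite_minimal Gsym Gfin (@class_closed x) (@class_conn x) hr (class_refl x)) => //.
    move=> H hH; have [UH|UH] := pselect (U H); first by left.
    by right; exact: vertex_star vU hH UH.
  exact: Uf (class_refl x).
have tsym : symm (tedge x) := tree_edge_symm (C := C x) (Hs := half x) (c := col x).
have tM U V : tedge x U V -> ori x V by move=> /tree_edge_orientation [].
have tc U V : ori x U -> ori x V -> conn (tedge x) U V.
  exact: (tree_conn C0 HsC HsN Hst nf ci).
have tf U : finite_set [set V | tedge x U V].
  exact: (finite_tree_edge (col x) HsC HsN Hst mf).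
have tb : bridges (tedge x) := tree_bridges HsC HsN Hst ci.
have pv y : C x y -> ori x (principal (half x) y).
  exact: vertex_principal Hst sf y.
have pin y z : C x y -> C x z -> principal (half x) y = principal (half x) z -> y = z.
  move=> Cy Cz e; apply: contrapT => yz.
  have : principal (half x) z [set y].
    rewrite -e; split=> //; split; first by exists y, y, 0; split=> //; left.
      by exists y.
    by exists z; split=> //; exact: nesym.
  by move=> [_ /= zy]; apply: yz.
split.
- exact: contracted_symm tsym.
- move=> y z; exact: (contracted_conn lex_irr lex_trans lex_total C0 pv pin tM tc tf).
- exact: (contracted_bridges lex_irr lex_trans tsym tb).
Qed.

End Coding.

(** * Gluing the trees of the classes into a treeing *)

Theorem theoremA (R : realType) (d : measure_display) (X : measurableType d)
    (hX : standard_borel R X)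
    (E : set (X * X)) (hE : countable_borel_equivalence E)
    (G : set (X * X)) (hG : graphing E G) (hGlf : locally_finite G)
    (hGqt : forall x : X, quasi_tree (path_dist R (component_graph G x))) :
  treeable E.
Proof.
have [Ggr mG GE] := hG; have [symG irrG] := Ggr.
have [phi [psi bc]] := standard_borel_code hX.
have [g [mg gG Gg]] := lusin_novikov bc mG hGlf.
pose S x y := G (x, y).
(* The points joined to [x] are reached by finite compositions of the sections [g k], and [n] codes
   the list of indices. As [g k] stays put where it gives no neighbour, every [f n x] is in the
   class of [x]. *)
pose f n x := foldl (fun y k => g k y) x (seq_of_nat n).
have fmeas n : measurable_fun setT (f n).
  rewrite /f; move: (seq_of_nat n) => s.
  elim/last_ind: s => [|s k IH] /=; first exact: measurable_id.
  by under eq_fun do rewrite foldl_rcons; exact: measurableT_comp (mg k) IH.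
have fconn x y : conn S x y <-> exists n, f n x = y.
  split.
    move=> [n]; elim: n y => [|n IH] y /=.
      by move=> <-; exists (pickle ([::] : seq nat)); rewrite /f seq_of_nat_pickle.
    move=> [/IH //|[z /IH [m mz] /Gg [k kz]]].
    exists (pickle (rcons (seq_of_nat m) k)).
    by rewrite /f seq_of_nat_pickle foldl_rcons -/(f m x) mz.
  move=> [n <-]; rewrite /f; move: (seq_of_nat n) => s.
  elim/last_ind: s => [|s k IH] /=; first exact: conn_refl.
  rewrite foldl_rcons; set z := foldl _ _ _ in IH *.
  have [h|->] := gG k z; last exact: IH.
  exact: conn_trans IH (conn_edge h).
have CE x : component G x = conn_class S x.
  by apply/seteqP; split=> y /connectednessE.
have bot x : exists r, bottleneck S (conn_class S x) r.
  by rewrite -CE; exact: quasi_tree_bottleneck Ggr (hGqt x).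
have mS : measurable [set p | S p.1 p.2].
  by rewrite (_ : [set _ | _] = G) //; apply/seteqP; split=> -[].
pose T := tree_graph phi S.
have spec := class_tree_spec (G := S) bc symG hGlf bot.
(* All base points of a class give the same tree, so [T] on the class of [x] is the tree seen from
   [x]. *)
have Tin x y z : conn S x y -> (T (y, z) <-> class_tree phi S x y z).
  by move=> xy; rewrite /T /tree_graph /= (class_tree_eq phi symG xy).
have Tconn x y z : conn S x y -> conn S x z -> conn (fun a b => T (a, b)) y z.
  move=> xy xz; have [_ h _] := spec x.
  apply: (conn_sub _ (h y z xy xz)) => a b ab; apply/(Tin x) => //.
  exact: (class_tree_mem ab).1.
have TS x y : T (x, y) -> conn S x y by move=> /class_tree_mem [].
have Tgr : is_graph T.
  split=> [x y xy|x [//]].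
  have Sxy := TS _ _ xy; apply/(Tin x) => //; have [sym _ _] := spec x.
  exact: sym.
have TSconn x y : conn (fun a b => T (a, b)) x y <-> conn S x y.
  split=> [|h]; last exact: Tconn (conn_refl _ _) h.
  move=> h; apply: (@conn_ind _ _ (conn S x) _ _ _ _ h); last exact: conn_refl.
  by move=> a b /TS ab xa; exact: conn_trans xa ab.
exists T; split.
  split=> //; first exact: (measurable_tree_graph (G := S) bc symG hGlf mS fmeas fconn bot).
  rewrite -GE; apply/seteqP; split=> -[x y] /connectednessE h; apply/connectednessE.
    exact/TSconn.
  exact/TSconn.
move=> x.
have memc (u : component T x) : conn S x (val u).
  by have /connectednessE /TSconn := set_valP u.
have gr : is_graph (component_graph T x).
  by case: Tgr => h1 h2; split=> [u v|u]; [exact: h1 | exact: h2].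
split=> //.
  apply/seteqP; split=> // -[u v] _; apply/connectednessE.
  have [n hn] := Tconn x _ _ (memc u) (memc v).
  by exists n; exact/dle_component_graph.
apply: bridges_acyclic gr _ => u v uv hc.
have [_ _ br] := spec x.
apply: (br (val u) (val v)); first exact/(Tin x).
apply: conn_lift hc => a b [ab n1 n2]; apply: conn_edge; split.
- exact/(Tin x).
- by move=> [e1 e2]; apply: n1; split; exact: val_inj.
- by move=> [e1 e2]; apply: n2; split; exact: val_inj.
Qed.
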